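(* Consider a hypothesis testing problem $(H_0,H_1)$ with a size-invariant expectation-gap statistic given by $Z(m),\tau_0,\tau_1,\sigma(m)$, let $0\le\delta\le\rho\le1$, $K=\lceil\lg(1/\rho)\rceil$, and let $t_k\in[2^{-k},1/2]$ for $k\in[K]$. Consider the algorithm: (1) take $\lceil 8\ln(1/\delta)\rceil$ batches of $m_{1/8}$ samples, compute $Z(m_{1/8})$ on each, take the median; accept if it is less than $\tau_0+\Delta/8$, reject if it exceeds $\tau_1-\Delta/8$, otherwise continue; (2) draw $r\sim\mathrm{Unif}([1/4,3/4])$; (3) for $k=1,\dots,K$: let $J_k=\lceil t_k^2 2^{2k}\rceil$ and $L_k=16(K-k+1)$; form $L_k$ independent means, each the average of $Z(m_{t_k})$ over $J_k$ independent batches of $m_{t_k}$ samples, and let $\hat V_k$ be the median of these $L_k$ means; accept if $\hat V_k\le\tau_0+(r-2^{-k})\Delta$, reject if $\hat V_k\ge\tau_0+(r+2^{-k})\Delta$, otherwise continue; (4) accept. This algorithm succeeds (accepts under $H_0$, rejects under $H_1$) with probability at least $1-\delta$, is $O(\rho)$-replicable, and takes $$O\left(m_{1/8}\log(1/\delta)+\sum_{k=1}^{K}2^{k}(K-k+1)t_k^2 m_{t_k}\right)$$ samples in expectation and $$O\left(m_{1/8}\log(1/\delta)+\sum_{k=1}^{K}2^{2k}(K-k+1)t_k^2 m_{t_k}\right)$$ samples in the worst case.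
   Context: An expectation-gap statistic for $(H_0,H_1)$ consists of a statistic $Z(m)$ computed from $m$ i.i.d. samples and real functions $\tau_0(m),\tau_1(m),\sigma(m)$ with $\mathbb{E}[Z(m)]\le\tau_0(m)$ under every distribution in $H_0$, $\mathbb{E}[Z(m)]\ge\tau_1(m)$ under every distribution in $H_1$, $\tau_1(m)\ge\tau_0(m)$ for all $m\ge m_{\min}$, and for every sampling distribution $\sqrt{\mathrm{Var}[Z(m)]}\le\sigma(m)\left(1+\max\left\{0,\frac{\mathbb{E}[Z(m)]-\tau_1(m)}{\Delta(m)},\frac{\tau_0(m)-\mathbb{E}[Z(m)]}{\Delta(m)}\right\}\right)$ with $\Delta(m)=\tau_1(m)-\tau_0(m)$. It is size-invariant if $\tau_0(m)=\tau_0$ and $\tau_1(m)=\tau_1$ are constant in $m$ and, for each sampling distribution, $\mathbb{E}[Z(m)]$ does not depend on $m$; then $\Delta=\tau_1-\tau_0$. Let $f(m)=\sigma(m)/\Delta$ and $m_t=\min\{m\ge m_{\min}: f(m)\le t/2\}$. An algorithm is $\rho'$-replicable if for every sampling distribution two runs on independent samples with the same internal randomness agree with probability at least $1-\rho'$; expected sample counts are over samples and internal randomness.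
   Formalization: δ>0 is required (for δ=0 the number of batches is infinite), and the two sample bounds are proved for δ at most any fixed δ_max<1, with a constant depending on δ_max, since the uniform O-bound fails as δ tends to 1 (e.g. ρ=1, K=0). *)

(* Defs.v *)
From HB Require Import structures.
From mathcomp Require Import all_boot all_order all_algebra.
From mathcomp Require Import all_classical all_reals all_analysis.

Set Implicit Arguments.
Unset Strict Implicit.
Unset Printing Implicit Defensive.

Import Order.TTheory GRing.Theory Num.Theory.
Import numFieldNormedType.Exports.

Local Open Scope classical_set_scope.
Local Open Scope ring_scope.

Section iid.
Context {d : measure_display} {X : measurableType d} {R : realType}.

Definition tuple_cons (n : nat) (w : X * n.-tuple X) : n.+1.-tuple X :=
  [the n.+1.-tuple X of w.1 :: w.2].

Lemma measurable_tuple_cons n : measurable_fun setT (@tuple_cons n).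
Proof. exact: measurable_cons. Qed.

HB.instance Definition _ n :=
  isMeasurableFun.Build _ _ _ _ (@tuple_cons n) (@measurable_tuple_cons n).

(* The law of [n] i.i.d. samples from [P], i.e. the [n]-fold product measure. *)
Fixpoint iid (P : probability X R) (n : nat) : probability (n.-tuple X) R :=
  match n return probability (n.-tuple X) R with
  | 0%N => \d_([tuple] : 0.-tuple X)
  | n'.+1 => distribution (P \x iid P n')%E (@tuple_cons n')
  end.

End iid.

Section algorithms.
Context {d : measure_display} {X : measurableType d} {R : realType}.

(* [model] is the class over which "every sampling distribution" ranges; it is
   [setT] when no restriction is placed on the sampling distribution. *)
Record testing_problem := TestingProblem {
  model : set (probability X R);
  null_hyp : set (probability X R);
  alt_hyp : set (probability X R);
  null_hyp_model : null_hyp `<=` model;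
  alt_hyp_model : alt_hyp `<=` model }.

(* An algorithm with internal randomness in [I] that draws at most [N] samples
   returns its verdict ([true] = accept) and the number of samples it drew.
   Its input is the list of the first [N] samples; the algorithm below reads
   it from left to right and leaves the samples it does not draw untouched. *)
Context {d' : measure_display} {I : measurableType d'}.
Variables (H : testing_problem) (Q : probability I R) (N : nat).
Variable A : I -> N.-tuple X -> bool * nat.

Definition verdict_prob (P : probability X R) (b : bool) : \bar R :=
  (Q \x iid P N)%E [set w | (A w.1 w.2).1 = b].

Definition succeeds (delta : R) : Prop :=
  (forall P, null_hyp H P -> ((1 - delta)%:E <= verdict_prob P true)%E) /\
  (forall P, alt_hyp H P -> ((1 - delta)%:E <= verdict_prob P false)%E).

Definition agreement_prob (P : probability X R) : \bar R :=
  (Q \x (iid P N \x iid P N))%E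
    [set w | (A w.1 w.2.1).1 = (A w.1 w.2.2).1].

Definition replicable (rho : R) : Prop :=
  forall P, model H P -> ((1 - rho)%:E <= agreement_prob P)%E.

Definition expected_samples (P : probability X R) : \bar R :=
  'E_(Q \x iid P N)[fun w => (A w.1 w.2).2%:R]%E.

Definition expected_samples_le (b : R) : Prop :=
  forall P, model H P -> (expected_samples P <= b%:E)%E.

Definition worst_case_samples_le (b : R) : Prop :=
  forall i s, (A i s).2%:R <= b.

End algorithms.
Arguments testing_problem {d} X R.

Section expectation_gap.
Context {d : measure_display} {X : measurableType d} {R : realType}.
Variables (H : testing_problem X R) (m_min : nat).
Variable Z : forall m : nat, {mfun m.-tuple X >-> R}.

Definition mean (P : probability X R) (m : nat) : R :=
  fine 'E_(iid P m)[Z m]%E.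

Definition stddev (P : probability X R) (m : nat) : R :=
  Num.sqrt (fine 'V_(iid P m)[Z m]%E).

(* The [Lfun] clause says that the moments in the other clauses exist.  The last
   clause has its intended meaning only for [0 < Delta], since [x / 0 = 0]. *)
Definition expectation_gap (tau0 tau1 sigma : nat -> R) : Prop :=
  forall m, (m_min <= m)%N ->
  let Delta := tau1 m - tau0 m in
  [/\ forall P, model H P -> (Z m : _ -> R) \in Lfun (iid P m) 2%:E,
      forall P, null_hyp H P -> mean P m <= tau0 m,
      forall P, alt_hyp H P -> tau1 m <= mean P m,
      tau0 m <= tau1 m &
      forall P, model H P ->
        stddev P m <= sigma m *
          (1 + Num.max 0 (Num.max ((mean P m - tau1 m) / Delta)
                                  ((tau0 m - mean P m) / Delta)))].

Definition size_invariant_expectation_gap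
    (tau0 tau1 : R) (sigma : nat -> R) : Prop :=
  expectation_gap (fun=> tau0) (fun=> tau1) sigma /\
  forall P, model H P -> forall m m', (m_min <= m)%N -> (m_min <= m')%N ->
    mean P m = mean P m'.

End expectation_gap.

Section batch_size.
Context {R : realType}.
Variables (m_min : nat) (f : nat -> R) (t : R).

Definition admissible_sizes : set nat :=
  [set m | (m_min <= m)%N /\ f m <= t / 2].

(* The minimum of [admissible_sizes], with junk value 0 if that set is empty. *)
Definition batch_size : nat :=
  xget 0%N [set m | admissible_sizes m /\
                    forall m', admissible_sizes m' -> (m <= m')%N].

End batch_size.

(* Only meaningful for [0 <= x]. *)
Definition natceil {R : realType} (x : R) : nat := `|Num.ceil x|%N.

(* For an even number of values this is the midpoint of the two middle ones. *)
Definition median {R : realType} (s : seq R) : R :=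
  let s' := sort <=%R s in
  (s'`_(size s).-1./2 + s'`_(size s)./2) / 2.

Definition average {R : realType} (s : seq R) : R :=
  (\sum_(v <- s) v) / (size s)%:R.

Section tester.
Context {d : measure_display} {X : measurableType d} {R : realType}.
Variable m_min : nat.
Variable Z : forall m : nat, {mfun m.-tuple X >-> R}.
Variables (tau0 tau1 : R) (sigma : nat -> R) (delta rho : R) (t : nat -> R).

Definition gap : R := tau1 - tau0.
Definition noise_ratio (m : nat) : R := sigma m / gap.
Definition msize (u : R) : nat := batch_size m_min noise_ratio u.

Definition num_rounds : nat := natceil (ln rho^-1 / ln 2).
Definition num_batches0 : nat := natceil (8 * ln delta^-1).
Definition num_batches (k : nat) : nat := natceil (t k ^+ 2 * 2 ^+ (2 * k)%N).
Definition num_means (k : nat) : nat := (16 * (num_rounds - k + 1))%N.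

(* [reshape] cuts [s] into [n] consecutive disjoint batches, each of size
   exactly [m] provided that [s] has at least [n * m] elements. *)
Definition batch_values (n m : nat) (s : seq X) : seq R :=
  [seq Z (size b) (in_tuple b) | b <- reshape (nseq n m) s].

Definition round_means (k : nat) (s : seq X) : seq R :=
  [seq average v | v <- reshape (nseq (num_means k) (num_batches k))
     (batch_values (num_means k * num_batches k)%N (msize (t k)) s)].

Definition cost0 : nat := (num_batches0 * msize (1 / 8)%R)%N.
Definition cost (k : nat) : nat :=
  (num_means k * num_batches k * msize (t k))%N.

Fixpoint rounds (ks : seq nat) (r : R) (s : seq X) : bool * nat :=
  if ks is k :: ks' then
    let V := median (round_means k s) in
    if V <= tau0 + (r - 2 ^- k) * gap then (true, cost k)
    else if tau0 + (r + 2 ^- k) * gap <= V then (false, cost k)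
    else let out := rounds ks' r (drop (cost k) s) in
         (out.1, cost k + out.2)%N
  else (true, 0%N).

Definition sample_budget : nat :=
  (cost0 + \sum_(1 <= k < num_rounds.+1) cost k)%N.

Definition tester (r : R) (s : sample_budget.-tuple X) : bool * nat :=
  let M := median (batch_values num_batches0 (msize (1 / 8)) s) in
  if M < tau0 + gap / 8 then (true, cost0)
  else if tau1 - gap / 8 < M then (false, cost0)
  else let out := rounds (iota 1 num_rounds) r (drop cost0 s) in
       (out.1, cost0 + out.2)%N.

Definition expected_bound : R :=
  (msize (1 / 8))%:R * ln delta^-1 +
  \sum_(1 <= k < num_rounds.+1)
     2 ^+ k * (num_rounds - k + 1)%N%:R * t k ^+ 2 * (msize (t k))%:R.

Definition worst_case_bound : R :=
  (msize (1 / 8))%:R * ln delta^-1 +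
  \sum_(1 <= k < num_rounds.+1)
     2 ^+ (2 * k)%N * (num_rounds - k + 1)%N%:R * t k ^+ 2 * (msize (t k))%:R.

End tester.
Arguments tester {d X R} m_min Z tau0 tau1 sigma delta rho t r s.

Lemma quarter_lt_three_quarters (R : realType) : (1 / 4 : R) < 3 / 4.
Proof. by rewrite ltr_pM2r ?invr_gt0// ltr1n. Qed.

Definition threshold_law (R : realType) : probability (measurableTypeR R) R :=
  uniform_prob (quarter_lt_three_quarters R).

(* Main.v *)
(** Writing mu for the mean of the statistic under the sampling distribution, both
    runs are compared with the ideal verdict "accept iff mu < tau0 + r Delta",
    which depends on the shared threshold r only. Chebyshev's inequality for a
    single batch (or an average of batches) and an exponential moment bound for
    the median show that stage 1 errs with probability at most delta, and that
    with k = K + 1 - n the median of round k is off by 2^-k Delta with probability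
    at most 8^-n. A run can disagree with the ideal verdict because of round k only
    if mu lies within O(2^-k) Delta of the threshold, an event of probability
    O(2^-k) = O(2^n rho) over r; summing 8^-n 2^n rho over n gives O(rho).
    For the expected sample count no concentration is needed: for any fixed
    sample, round k is left undecided with probability O(2^-k) over r alone. *)

Require Import Defs.
From mathcomp Require Import all_boot all_order all_algebra.
From mathcomp Require Import all_classical all_reals all_analysis.
From mathcomp Require Import measurable_realfun.
From mathcomp Require Import zify ring lra.

Set Implicit Arguments.
Unset Strict Implicit.
Unset Printing Implicit Defensive.

Import Order.TTheory GRing.Theory Num.Theory.
Import numFieldNormedType.Exports.

Local Open Scope classical_set_scope.
Local Open Scope ring_scope.

(** All stages read consecutive blocks of one i.i.d. sample. Independence of the blocks is never
    stated as such: its role is taken by an inequality for integrals of nonnegative functions over a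
    concatenation, obtained from Tonelli's theorem one sample at a time. This is why every quantity
    is kept nonnegative and only bounded from above, and why statistics are functions on sequences
    of any length, which can be evaluated on prefixes and suffixes. A second obstacle is that the
    standard deviation may grow once mu leaves [[tau0, tau1]]. It grows by the factor [1 + excess],
    so the tail radius of stage 1 is [Delta * (1 + excess) / 8], whereas the distance from mu to the
    stage 1 cutoff on the far side of the nearer endpoint is [Delta * (1 / 8 + excess)]. Stage 1
    alone thus settles these distributions, and the rounds are analysed only for mu in
    [[tau0, tau1]], where [excess] vanishes. The batch sizes keep the standard deviation below half
    of the tolerance at every stage, so that Chebyshev's inequality yields 1/4 throughout. *)

(** * Medians and far values *)

Section median.
Variable R : realType.
Implicit Types (s : seq R) (x e : R).

(** If the midpoint of the two middle values is at least [x + e], so is the upper middle value, and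
    with it everything sorted after it, which is at least half of the values. On the other side the
    lower middle value plays the same role. *)
Lemma median_far s x e : e <= `|median s - x| ->
  (size s <= 2 * count (fun v => e <= `|v - x|)%R s)%N.
Proof.
rewrite /median; set s' := sort <=%R s => h.
have ss : sorted <=%R s' by exact: sort_le_sorted.
have sz : size s' = size s by rewrite size_sort.
have cE p : count p s = count p s' by apply/permP; rewrite perm_sym perm_sort.
have [->//|n0] := posnP (size s).
have ab : s'`_(size s).-1./2 <= s'`_(size s)./2.
  apply: (sorted_leq_nth le_trans le_refl) => //; rewrite ?inE ?sz.
  - by have := odd_double_half (size s).-1; lia.
  - by have := odd_double_half (size s); lia.
  - by apply: half_leq; lia.
have mono (p q : pred R) : (forall v, p v -> q v) -> (count p s <= count q s)%N.
  by move=> pq; apply: sub_count.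
rewrite leqNgt; apply/negP => cl.
move: h; rewrite lter_normr => /orP[h|h].
- pose p : pred R := fun v => x + e <= v.
  have c1 : (count p s <= count (fun v => e <= `|v - x|)%R s)%N.
    by apply: mono => v h1; rewrite ler_normr; apply/orP; left; move: h1; rewrite /p; lra.
  have : s'`_(size s)./2 < x + e.
    apply: nth_count_lt => //; rewrite -cE.
    have := count_predC p s.
    rewrite (@eq_count _ (predC p) (Order.gt (x + e))); last first.
      by move=> v /=; rewrite -ltNge.
    move: c1 cl; move: (count p s) (count _ s) (count _ s) => c q c'.
    by have := odd_double_half (size s); lia.
  by move: h ab; lra.
- have c1 : (count (Order.ge (x - e)%R) s <= count (fun v => e <= `|v - x|)%R s)%N.
    by apply: mono => v /= h1; rewrite ler_normr; apply/orP; right; lra.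
  have : x - e < s'`_(size s).-1./2.
    apply: nth_count_gt => //; rewrite -cE sz; move: c1 cl; move: (count _ s) (count _ s) => c c'.
    by have := odd_double_half (size s).-1; lia.
  by move: h ab; lra.
Qed.

End median.

(** * Cutting sequences into equal blocks *)

Section reshape_nseq.
Variable T : Type.
Implicit Types s : seq T.

Lemma reshape_nseqD J r m s : reshape (nseq (J + r) m) s =
  reshape (nseq J m) (take (J * m) s) ++ reshape (nseq r m) (drop (J * m) s).
Proof.
elim: J s => [|J IH] s; first by rewrite mul0n drop0.
by rewrite addSn /= IH mulSn take_takel ?leq_addr// take_drop drop_drop [(J * m + m)%N]addnC.
Qed.

Lemma dropl_cat m s1 s2 : (m <= size s1)%N ->
  drop m (s1 ++ s2) = drop m s1 ++ s2.
Proof.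
rewrite drop_cat leq_eqVlt => /orP[/eqP->|->//].
by rewrite ltnn subnn drop0 drop_size.
Qed.

Lemma reshape_nseq_cat n m s1 s2 : size s1 = (n * m)%N ->
  reshape (nseq n m) (s1 ++ s2) = reshape (nseq n m) s1.
Proof.
elim: n s1 s2 => [//|n IH] s1 s2 h /=.
have hm : (m <= size s1)%N by rewrite h mulSn leq_addr.
rewrite takel_cat// dropl_cat// IH// size_drop h mulSn.
by rewrite addKn.
Qed.

Lemma size_reshape_nseq n m s : size (reshape (nseq n m) s) = n.
Proof. by rewrite size_reshape size_nseq. Qed.

(** Grouping batch values afterwards amounts to cutting the samples into large blocks first. Each of
    the [L] means thereby becomes a function of its own contiguous block, so one theory of blockwise
    statistics serves both levels. *)
Lemma map_reshape_reshape (U V : Type) (f : seq T -> U) (h : seq U -> V) L J m s :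
  [seq h v | v <- reshape (nseq L J)
     [seq f b | b <- reshape (nseq (L * J) m) s]] =
  [seq h [seq f b | b <- reshape (nseq J m) c]
     | c <- reshape (nseq L (J * m)) s].
Proof.
elim: L s => [//|L IH] s /=.
rewrite mulSn reshape_nseqD map_cat take_size_cat ?size_map ?size_reshape_nseq//.
by rewrite drop_size_cat ?size_map ?size_reshape_nseq// IH.
Qed.

End reshape_nseq.

(** * Measurability of sorted entries, medians and averages *)

Lemma measurable_indicator (R : realType) d (T : measurableType d) (b : T -> bool) :
  measurable_fun setT b -> measurable_fun setT (fun r => (b r)%:R : R).
Proof.
move=> mb; rewrite [X in measurable_fun _ X](_ : _ =
  (fun r => if b r then 1 else 0 : R)); last first.
  by apply/funext => s; case: (b s).
exact: measurable_fun_ifT.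
Qed.

Section measurable_seq.
Context {d : measure_display} {T : measurableType d} {R : realType}.
Variables (N : nat) (F : T -> seq R).
Hypothesis size_F : forall t, size (F t) = N.
Hypothesis measurable_F : forall i, measurable_fun setT (fun t => (F t)`_i).

Lemma measurable_count_le x : measurable_fun setT (fun t => count (Order.ge x) (F t)).
Proof.
rewrite [X in measurable_fun _ X](_ : _ = fun t =>
    (\sum_(j < N) nat_of_bool ((F t)`_j <= x)%R)%N); last first.
  apply/funext => t; rewrite -sum1_count big_mkcond (big_nth 0) big_mkord size_F.
  by apply: eq_bigr => j _ /=; case: ifP.
elim: N => [|n IH].
  by under eq_fun do rewrite big_ord0; exact: measurable_cst.
under eq_fun do rewrite big_ord_recr /=.
apply: measurable_fun_addn => //.
apply: (@measurableT_comp _ _ _ _ _ _ nat_of_bool); first by [].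
by apply: measurable_fun_ler.
Qed.

(** The sorted entry at index [i] exceeds [x] exactly when at most [i] entries are [<= x], so the
    preimage of a ray is described by a measurable count. Beyond the length the entry is the default
    0. *)
Lemma measurable_nth_sort i : measurable_fun setT (fun t => (sort <=%R (F t))`_i).
Proof.
have [iN|Ni] := ltnP i N; last first.
  rewrite [X in measurable_fun _ X](_ : _ = cst 0)//.
  by apply/funext => t; rewrite nth_default// size_sort size_F.
apply: (measurability _ (RGenOInfty.measurableE R)) => /= _ [_ [x ->] <-].
rewrite setTI (_ : _ @^-1` _ =
    [set t | (count (Order.ge x) (F t) <= i)%N]); last first.
  apply/seteqP; split => t /=; rewrite in_itv /= andbT -(permP (permEl (perm_sort <=%R _))).
    move=> h; rewrite leqNgt; apply/negP => c.
    by have := nth_count_le 0 (sort_le_sorted _) c; rewrite leNgt h.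
  move=> h; apply: (nth_count_gt 0 (sort_le_sorted (F t))).
  by rewrite h size_sort size_F.
have mi : measurable_fun setT (fun t => count (Order.ge x) (F t) <= i)%N.
  by apply: measurable_fun_leq => //; exact: measurable_count_le.
by have := mi measurableT [set true] I; rewrite setTI.
Qed.

Lemma measurable_median : measurable_fun setT (fun t => median (F t)).
Proof.
rewrite /median; under eq_fun do rewrite size_F.
apply: measurable_funM => //.
by apply: measurable_funD; exact: measurable_nth_sort.
Qed.

Lemma measurable_average : measurable_fun setT (fun t => average (F t)).
Proof.
rewrite /average; under eq_fun do rewrite size_F.
apply: measurable_funM => //.
under eq_fun do rewrite (big_nth 0) size_F big_mkord.
exact: measurable_sum.
Qed.

End measurable_seq.

(** * Measurable functions on sequences of varying length *)

Section measurable_on_seq.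
Context {d : measure_display} {X : measurableType d}.

(** Requiring measurability at every length at once makes the notion stable under [take], [drop] and
    [::], which change the length of the tuple. *)
Definition seq_measurable {d'} {T : measurableType d'} (G : seq X -> T) :=
  forall n, measurable_fun setT (fun s : n.-tuple X => G s).

Lemma measurable_take_tuple c n :
  measurable_fun setT (fun s : n.-tuple X => [tuple of take c s]).
Proof.
apply/measurable_fun_tnthP => i.
have iN : (i < n)%N by apply: leq_trans (ltn_ord i) _; rewrite geq_minr.
have ic : (i < c)%N by apply: leq_trans (ltn_ord i) _; rewrite geq_minl.
rewrite (_ : _ \o _ = (fun s : n.-tuple X => tnth s (Ordinal iN))).
  exact: measurable_tnth.
apply/funext => s /=.
have x0 : X := tnth s (Ordinal iN).
by rewrite !(tnth_nth x0) /= nth_take.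
Qed.

Lemma measurable_drop_tuple c n :
  measurable_fun setT (fun s : n.-tuple X => [tuple of drop c s]).
Proof.
apply/measurable_fun_tnthP => i.
have iN : (c + i < n)%N by have := ltn_ord i; lia.
rewrite (_ : _ \o _ = (fun s : n.-tuple X => tnth s (Ordinal iN))).
  exact: measurable_tnth.
apply/funext => s /=.
have x0 : X := tnth s (Ordinal iN).
by rewrite !(tnth_nth x0) /= nth_drop.
Qed.

Context {d' : measure_display} {T : measurableType d'}.
Implicit Types G : seq X -> T.

Lemma seq_measurable_take c G : seq_measurable G ->
  seq_measurable (fun s => G (take c s)).
Proof.
by move=> mG n; exact: measurableT_comp (mG _) (@measurable_take_tuple c n).
Qed.

Lemma seq_measurable_drop c G : seq_measurable G ->
  seq_measurable (fun s => G (drop c s)).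
Proof.
by move=> mG n; exact: measurableT_comp (mG _) (@measurable_drop_tuple c n).
Qed.

Lemma seq_measurable_cons x G : seq_measurable G ->
  seq_measurable (fun s => G (x :: s)).
Proof.
move=> mG n; apply: (@measurableT_comp _ _ _ _ _ _ (fun s : n.+1.-tuple X => G s)
  _ (fun s : n.-tuple X => [the n.+1.-tuple X of x :: s])); first exact: mG.
apply: (@measurable_cons _ _ _ _ (cst x) n id) => //.
Qed.

Lemma seq_measurable_cat s1 G : seq_measurable G ->
  seq_measurable (fun s => G (s1 ++ s)).
Proof.
elim: s1 G => [//|x s1 IH] G mG.
by apply: (IH (fun s => G (x :: s))); exact: seq_measurable_cons.
Qed.

End measurable_on_seq.

(** * Measurability of blockwise statistics *)

Section measurable_blocks.
Context {d : measure_display} {X : measurableType d} {R : realType}.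
Implicit Types g : seq X -> R.

Lemma nth_reshape_nseq (T : Type) n c (s : seq T) i : (i < n)%N ->
  nth [::] (reshape (nseq n c) s) i = take c (drop (i * c) s).
Proof.
elim: n s i => [//|n IH] s [|i] ilt /=; first by rewrite mul0n drop0.
by rewrite IH// drop_drop mulSn addnC.
Qed.

Definition block_values g n c (s : seq X) := [seq g b | b <- reshape (nseq n c) s].

Lemma size_block_values g n c s : size (block_values g n c s) = n.
Proof. by rewrite size_map size_reshape_nseq. Qed.

Lemma seq_measurable_nth_block_values g n c i : seq_measurable g ->
  seq_measurable (fun s => (block_values g n c s)`_i).
Proof.
move=> mg; have [iN|Ni] := ltnP i n; last first.
  move=> m; rewrite [X in measurable_fun _ X](_ : _ = cst 0)//.
  by apply/funext => s; rewrite nth_default// size_block_values.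
have -> : (fun s => (block_values g n c s)`_i) =
    (fun s => g (take c (drop (i * c) s))).
  apply/funext => s; rewrite /block_values (nth_map [::]) ?size_reshape_nseq//.
  by rewrite nth_reshape_nseq.
by apply: (@seq_measurable_drop _ X _ _ (i * c) (g \o take c)); exact: seq_measurable_take.
Qed.

Lemma seq_measurable_median_blocks g n c : seq_measurable g ->
  seq_measurable (fun s => median (block_values g n c s)).
Proof.
move=> mg m; apply: (@measurable_median _ _ _ n) => [t|i].
  exact: size_block_values.
exact: seq_measurable_nth_block_values.
Qed.

Lemma seq_measurable_average_blocks g n c : seq_measurable g ->
  seq_measurable (fun s => average (block_values g n c s)).
Proof.
move=> mg m; apply: (@measurable_average _ _ _ n) => [t|i].
  exact: size_block_values.
exact: seq_measurable_nth_block_values.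
Qed.

Variable Z : forall m : nat, {mfun m.-tuple X >-> R}.

Definition seq_stat (b : seq X) : R := Z (size b) (in_tuple b).

Lemma seq_statE n (s : n.-tuple X) : seq_stat s = Z n s.
Proof.
rewrite /seq_stat; case: s => s i /=; have /eqP e := i; subst n.
by congr (Z _ _); exact: val_inj.
Qed.

Lemma seq_measurable_stat : seq_measurable seq_stat.
Proof.
move=> n; under eq_fun do rewrite seq_statE.
exact: measurable_funP.
Qed.

End measurable_blocks.

(** * Integrals over i.i.d. samples and over concatenations *)

Section iid_integral.
Context {d : measure_display} {X : measurableType d} {R : realType}.
Variable P : probability X R.
Implicit Types F G H : seq X -> R.

Definition iid_integral n F : \bar R := (\int[iid P n]_s (F s)%:E)%E.

Lemma seq_measurable_EFin n F : seq_measurable F ->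
  measurable_fun setT (fun s : n.-tuple X => (F s)%:E).
Proof. by move=> mF; apply/measurable_EFinP; exact: mF. Qed.

Lemma iid_integral_ge0 n F : (forall s, 0 <= F s) -> (0 <= iid_integral n F)%E.
Proof. by move=> F0; apply: integral_ge0 => s _; rewrite lee_fin. Qed.

Lemma iid_integral_cst n c : iid_integral n (fun=> c) = c%:E.
Proof.
by rewrite /iid_integral integral_cst//= probability_setT mule1.
Qed.

Lemma iid_integral0 F : seq_measurable F -> iid_integral 0 F = (F [::])%:E.
Proof.
move=> mF; rewrite /iid_integral /= integral_dirac//.
  by rewrite diracE in_setT mul1e.
exact: seq_measurable_EFin.
Qed.

Lemma measurable_cons_prod n F : seq_measurable F ->
  measurable_fun setT (fun w : X * n.-tuple X => (F (w.1 :: w.2))%:E).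
Proof.
move=> mF; apply: (@measurableT_comp _ _ _ _ _ _
  (fun s : n.+1.-tuple X => (F s)%:E) _ (@tuple_cons _ X n)).
  exact: seq_measurable_EFin.
exact: measurable_tuple_cons.
Qed.

Lemma iid_integralS n F : seq_measurable F -> (forall s, 0 <= F s) ->
  iid_integral n.+1 F =
  (\int[P]_x iid_integral n (fun s => F (x :: s)))%E.
Proof.
move=> mF F0; rewrite /iid_integral /= ge0_integral_distribution; last 2 first.
- exact: (seq_measurable_EFin (n := n.+1)).
- by move=> s; rewrite lee_fin.
rewrite (fubini_tonelli1 (fun w : X * n.-tuple X => (F (w.1 :: w.2))%:E))//.
- exact: measurable_cons_prod.
- by move=> w; rewrite lee_fin.
Qed.

Lemma measurable_iid_integral_cons n F : seq_measurable F ->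
  (forall s, 0 <= F s) ->
  measurable_fun setT (fun x => iid_integral n (fun s => F (x :: s))).
Proof.
move=> mF F0; apply: (measurable_fun_fubini_tonelli_F
  (fun w : X * n.-tuple X => (F (w.1 :: w.2))%:E)).
- exact: measurable_cons_prod.
- by move=> w; rewrite lee_fin.
Qed.

Lemma le_iid_integral n F G : seq_measurable F -> seq_measurable G ->
  (forall s, 0 <= F s) -> (forall s, size s = n -> F s <= G s) ->
  (iid_integral n F <= iid_integral n G)%E.
Proof.
move=> mF mG F0 FG; apply: ge0_le_integral => //.
- by move=> s _; rewrite lee_fin.
- exact: seq_measurable_EFin.
- exact: seq_measurable_EFin.
- by move=> s _; rewrite lee_fin FG// size_tuple.
Qed.

(** Conditioning on the first [m] samples, which are peeled off one by one to follow the recursion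
    in [iid]. Since [G] is given and measurable, the inner integral need not be shown measurable as
    a function of [s1]. *)
Lemma iid_integral_cat_le m n F G : seq_measurable F -> seq_measurable G ->
  (forall s, 0 <= F s) -> (forall s, 0 <= G s) ->
  (forall s1, size s1 = m ->
     (iid_integral n (fun s2 => F (s1 ++ s2)%SEQ) <= (G s1)%:E)%E) ->
  (iid_integral (m + n) F <= iid_integral m G)%E.
Proof.
elim: m F G => [|m IH] F G mF mG F0 G0 FG.
  by rewrite iid_integral0// (FG [::]).
rewrite addSn !iid_integralS//; apply: ge0_le_integral => //.
- by move=> x _; exact: iid_integral_ge0.
- exact: measurable_iid_integral_cons.
- exact: measurable_iid_integral_cons.
- move=> x _; apply: IH => //; try exact: seq_measurable_cons.
  by move=> s1 s1m; apply: (FG (x :: s1)); rewrite /= s1m.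
Qed.

Lemma iid_integralD n F G : seq_measurable F -> seq_measurable G ->
  (forall s, 0 <= F s) -> (forall s, 0 <= G s) ->
  iid_integral n (fun s => F s + G s) = (iid_integral n F + iid_integral n G)%E.
Proof.
move=> mF mG F0 G0; rewrite /iid_integral -ge0_integralD//.
- by move=> s _; rewrite lee_fin.
- exact: seq_measurable_EFin.
- by move=> s _; rewrite lee_fin.
- exact: seq_measurable_EFin.
Qed.

Lemma iid_integralZ n c F : seq_measurable F -> (forall s, 0 <= F s) ->
  0 <= c -> iid_integral n (fun s => c * F s) = (c%:E * iid_integral n F)%E.
Proof.
move=> mF F0 c0; rewrite /iid_integral -ge0_integralZl//.
- exact: seq_measurable_EFin.
- by move=> s _; rewrite lee_fin.
Qed.

Lemma seq_measurableD F G : seq_measurable F -> seq_measurable G ->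
  seq_measurable (fun s => F s + G s).
Proof. by move=> mF mG n; apply: measurable_funD; [exact: mF|exact: mG]. Qed.

Lemma seq_measurableZ c F : seq_measurable F -> seq_measurable (fun s => c * F s).
Proof. by move=> mF n; apply: measurable_funM => //; exact: mF. Qed.

Lemma seq_measurable_cst (c : R) : seq_measurable (fun _ : seq X => c : R).
Proof. by move=> n; exact: measurable_cst. Qed.

(** A union bound over two consecutive blocks: a failure is charged to the first block, or with
    weight [c] to the second. *)
Lemma iid_integral_cat_leD m n F G H (u v c : R) :
  seq_measurable F -> seq_measurable G -> seq_measurable H ->
  (forall s, 0 <= F s) -> (forall s, 0 <= G s) -> (forall s, 0 <= H s) ->
  0 <= c -> 0 <= v ->
  (forall s1 s2, size s1 = m -> size s2 = n -> F (s1 ++ s2) <= G s1 + c * H s2) ->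
  (iid_integral m G <= u%:E)%E -> (iid_integral n H <= v%:E)%E ->
  (iid_integral (m + n) F <= (u + c * v)%:E)%E.
Proof.
move=> mF mG mH F0 G0 H0 c0 v0 FGH Gu Hv.
have cv0 : 0 <= c * v by exact: mulr_ge0.
apply: (@le_trans _ _ (iid_integral m (fun s => G s + c * v))).
  apply: iid_integral_cat_le => //.
  - by apply: seq_measurableD => //; exact: seq_measurable_cst.
  - by move=> s; rewrite addr_ge0.
  move=> s1 s1m.
  apply: (@le_trans _ _ (iid_integral n (fun s => G s1 + c * H s))).
    apply: le_iid_integral => //.
    - exact: seq_measurable_cat.
    - apply: seq_measurableD; first exact: seq_measurable_cst.
      exact: seq_measurableZ.
    - by move=> s2 s2n; exact: FGH.
  rewrite (@iid_integralD n (fun=> G s1)) //; last 2 first.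
  - exact: seq_measurableZ.
  - by move=> s; rewrite mulr_ge0.
  rewrite iid_integralZ// iid_integral_cst EFinD EFinM leeD2l//.
  by rewrite lee_wpmul2l.
rewrite (@iid_integralD m G (fun=> c * v))//.
by rewrite iid_integral_cst EFinD leeD2r.
Qed.

(** The multiplicative counterpart, meant for exponential moments of independent blocks. *)
Lemma iid_integral_cat_leM m n F G H (u v : R) :
  seq_measurable F -> seq_measurable G -> seq_measurable H ->
  (forall s, 0 <= F s) -> (forall s, 0 <= G s) -> (forall s, 0 <= H s) ->
  0 <= v ->
  (forall s1 s2, size s1 = m -> size s2 = n -> F (s1 ++ s2) <= G s1 * H s2) ->
  (iid_integral m G <= u%:E)%E -> (iid_integral n H <= v%:E)%E ->
  (iid_integral (m + n) F <= (u * v)%:E)%E.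
Proof.
move=> mF mG mH F0 G0 H0 v0 FGH Gu Hv.
apply: (@le_trans _ _ (iid_integral m (fun s => v * G s))).
  apply: iid_integral_cat_le => //.
  - exact: seq_measurableZ.
  - by move=> s; rewrite mulr_ge0.
  move=> s1 s1m.
  apply: (@le_trans _ _ (iid_integral n (fun s => G s1 * H s))).
    apply: le_iid_integral => //.
    - exact: seq_measurable_cat.
    - exact: seq_measurableZ.
    - by move=> s2 s2n; exact: FGH.
  by rewrite iid_integralZ// mulrC EFinM lee_wpmul2l// lee_fin.
by rewrite iid_integralZ// mulrC EFinM lee_wpmul2l// lee_fin.
Qed.

End iid_integral.

(** * Second moments and median tails over independent blocks *)

Section block_bounds.
Context {d : measure_display} {X : measurableType d} {R : realType}.
Variable P : probability X R.
Implicit Types g h : seq X -> R.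

Lemma block_values_cat g n c s1 s2 : size s1 = c ->
  block_values g n.+1 c (s1 ++ s2) = g s1 :: block_values g n c s2.
Proof.
by move=> h; rewrite /block_values /= take_size_cat// drop_size_cat.
Qed.

Lemma seq_measurable_bool (b : seq X -> bool) : seq_measurable b ->
  seq_measurable (fun s => (b s)%:R : R).
Proof. by move=> mb n; apply: measurable_indicator; exact: mb. Qed.

Lemma seq_measurable_neq (b : seq X -> bool) c : seq_measurable b ->
  seq_measurable (fun s => b s != c).
Proof.
move=> mb n; case: c; last first.
  by apply: (eq_measurable_fun (fun s : n.-tuple X => b s)); [move=> s _; case: (b s)|exact: mb].
apply: (eq_measurable_fun (fun s : n.-tuple X => ~~ b s)).
  by move=> s _; case: (b s).
by apply: measurable_neg; exact: mb.
Qed.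

Lemma seq_measurable_sum_blocks g n c : seq_measurable g ->
  seq_measurable (fun s => \sum_(v <- block_values g n c s) v).
Proof.
move=> mg; elim: n => [|n IH].
  by under eq_fun do rewrite big_nil; exact: seq_measurable_cst.
rewrite [X in seq_measurable X](_ : _ = (fun s => g (take c s) +
    \sum_(v <- block_values g n c (drop c s)) v)); last first.
  by apply/funext => s; rewrite big_cons.
apply: seq_measurableD; first exact: seq_measurable_take.
exact: (seq_measurable_drop c IH).
Qed.

Lemma seq_measurable_prod_blocks g n c : seq_measurable g ->
  seq_measurable (fun s => \prod_(v <- block_values g n c s) v).
Proof.
move=> mg; elim: n => [|n IH].
  by under eq_fun do rewrite big_nil; exact: seq_measurable_cst.
rewrite [X in seq_measurable X](_ : _ = (fun s => g (take c s) *
    \prod_(v <- block_values g n c (drop c s)) v)); last first.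
  by apply/funext => s; rewrite big_cons.
move=> k; apply: measurable_funM; first exact: (seq_measurable_take c mg).
exact: (seq_measurable_drop c IH).
Qed.

Lemma seq_measurable_sqr g : seq_measurable g ->
  seq_measurable (fun s => g s ^+ 2).
Proof. by move=> mg n; apply: measurable_funX; exact: mg. Qed.

(* Carrying the offset [a] through the induction avoids integrating the signed
   cross terms. *)
Lemma iid_integral_sum_blocks h m (v : R) J (a : R) : seq_measurable h -> 0 <= v ->
  (forall a : R, iid_integral P m (fun b => ((a + h b) ^+ 2)%R) <= (a ^+ 2 + v)%:E)%E ->
  (iid_integral P (J * m)
     (fun s => ((a + \sum_(y <- block_values h J m s) y) ^+ 2)%R)
   <= (a ^+ 2 + J%:R * v)%:E)%E.
Proof.
move=> mh v0 hv; elim: J a => [|J IH] a.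
  rewrite (_ : (fun _ => _) = (fun=> a ^+ 2)) ?iid_integral_cst ?mul0r ?addr0//.
  by apply/funext => s; rewrite big_nil addr0.
have mF J' a' : seq_measurable
    (fun s => (a' + \sum_(y <- block_values h J' m s) y) ^+ 2).
  apply: seq_measurable_sqr; apply: seq_measurableD.
    exact: seq_measurable_cst.
  exact: seq_measurable_sum_blocks.
have Jv0 : 0 <= J%:R * v by rewrite mulr_ge0.
have mG : seq_measurable (fun s => (a + h s) ^+ 2).
  by apply: seq_measurable_sqr; apply: seq_measurableD => //; exact: seq_measurable_cst.
rewrite mulSn; apply: (@le_trans _ _
    (iid_integral P m (fun s => ((a + h s) ^+ 2 + J%:R * v)%R))).
  apply: iid_integral_cat_le => //.
  - by apply: seq_measurableD => //; exact: seq_measurable_cst.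
  - by move=> s; exact: sqr_ge0.
  - by move=> s; rewrite addr_ge0// sqr_ge0.
  move=> s1 s1m; apply: le_trans (IH (a + h s1)).
  rewrite le_eqVlt; apply/orP; left; apply/eqP; congr iid_integral.
  by apply/funext => s2; rewrite block_values_cat// big_cons addrA.
rewrite (@iid_integralD _ _ _ _ _ _ (fun=> J%:R * v))//; last first.
  by move=> s; exact: sqr_ge0.
rewrite iid_integral_cst (le_trans (leeD2r _ (hv a)))// -EFinD lee_fin.
by rewrite -addrA -[J.+1]add1n natrD mulrDl mul1r.
Qed.

Lemma prod_block_values_far g (x e : R) n c (s : seq X) :
  \prod_(v <- block_values (fun b => 4 ^+ (e <= `|g b - x|)%R : R) n c s) v =
  4 ^+ count (fun v => e <= `|v - x|)%R (block_values g n c s).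
Proof.
rewrite /block_values big_map; elim: (reshape _ _) => [|b bs IH].
  by rewrite big_nil.
by rewrite big_cons IH /= exprD.
Qed.

Lemma seq_measurable_far g (x e : R) : seq_measurable g ->
  seq_measurable (fun s => e <= `|g s - x|).
Proof.
move=> mg n; apply: measurable_fun_ler => //.
by apply: measurableT_comp => //; apply: measurable_funB => //; exact: mg.
Qed.

(* By Chebyshev each block is far from [x] with probability at most 1/4; weighing
   each far block by 4 gives mean at most 7/4 per block, whereas a far median
   forces a total weight of at least [2 ^ n]. *)
Lemma median_blocks_tail g (x e : R) n c : seq_measurable g -> 0 < e ->
  (iid_integral P c (fun b => ((g b - x) ^+ 2)%R) <= (e ^+ 2 / 4)%:E)%E ->
  (iid_integral P (n * c)
     (fun s => ((e <= `|median (block_values g n c s) - x|)%R%:R)%R)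
   <= ((7 / 8) ^+ n)%:E)%E.
Proof.
move=> mg e0 hg.
pose w b : R := 4 ^+ (e <= `|g b - x|)%R.
have wE b : w b = 1 + 3 * (e <= `|g b - x|)%R%:R.
  by rewrite /w; case: (_ <= _) => /=; rewrite ?expr1 ?expr0; ring.
have mfar := seq_measurable_bool (seq_measurable_far x e mg).
have mw : seq_measurable w.
  rewrite (_ : w = fun b => 1 + 3 * (e <= `|g b - x|)%R%:R); last exact/funext.
  by apply: seq_measurableD; [exact: seq_measurable_cst|exact: seq_measurableZ].
have w0 b : 0 <= w b by rewrite /w exprn_ge0.
have farE : (iid_integral P c (fun b => ((e <= `|g b - x|)%R%:R)%R) <= (1 / 4)%:E)%E.
  have m2 : seq_measurable (fun b => (g b - x) ^+ 2).
    by apply: seq_measurable_sqr; apply: (seq_measurableD mg); exact: seq_measurable_cst.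
  apply: (@le_trans _ _ (iid_integral P c (fun b => (e ^- 2 * (g b - x) ^+ 2)%R))).
    apply: le_iid_integral => //; first exact: seq_measurableZ.
    move=> b _; have [h|h] := boolP (e <= _); last first.
      by rewrite mulr_ge0// ?invr_ge0 ?sqr_ge0.
    rewrite mulrC ler_pdivlMr ?exprn_gt0// mul1r -[leRHS]real_normK ?num_real//.
    by rewrite ler_sqr ?nnegrE ?normr_ge0// ltW.
  rewrite iid_integralZ//; last 2 first.
  - by move=> s; exact: sqr_ge0.
  - by rewrite invr_ge0 sqr_ge0.
  apply: le_trans (lee_wpmul2l _ hg) _; first by rewrite lee_fin invr_ge0 sqr_ge0.
  by rewrite -EFinM lee_fin mulrA mulVf ?expf_neq0 ?gt_eqF.
have wle : (iid_integral P c w <= (7 / 4)%:E)%E.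
  rewrite (_ : w = fun b => 1 + 3 * (e <= `|g b - x|)%R%:R); last exact/funext.
  rewrite (@iid_integralD _ _ _ _ _ (fun=> 1))//; last exact: seq_measurableZ.
  rewrite iid_integral_cst iid_integralZ//.
  apply: (le_trans (leeD2l _ (lee_wpmul2l _ farE))) => //.
  by rewrite -EFinM -EFinD lee_fin; lra.
have prodle : (iid_integral P (n * c)
    (fun s => (\prod_(v <- block_values w n c s) v)%R) <= ((7 / 4) ^+ n)%:E)%E.
  have mp k := @seq_measurable_prod_blocks w k c mw.
  have p0 k s : 0 <= \prod_(v <- block_values w k c s) v.
    by rewrite /block_values big_map; apply: prodr_ge0.
  elim: n => [|k IH].
    rewrite (_ : (fun _ => _) = (fun=> 1)) ?iid_integral_cst ?expr0//.
    by apply/funext => s; rewrite big_nil.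
  rewrite mulSn exprS; apply: (@iid_integral_cat_leM _ _ _ _ _ _ _ w
    (fun s => \prod_(v <- block_values w k c s) v)) => //.
  by move=> s1 s2 s1c _; rewrite block_values_cat// big_cons.
apply: (@le_trans _ _ (iid_integral P (n * c) (fun s => (2 ^- n *
    \prod_(v <- block_values w n c s) v)%R))).
  apply: le_iid_integral => //.
  - apply: seq_measurable_bool; apply: seq_measurable_far.
    exact: seq_measurable_median_blocks.
  - by apply: seq_measurableZ; exact: seq_measurable_prod_blocks.
  move=> s _; rewrite prod_block_values_far; have [h|h] := boolP (e <= _); last first.
    by rewrite mulr_ge0// ?invr_ge0 ?exprn_ge0.
  rewrite mulrC ler_pdivlMr ?exprn_gt0// mul1r.
  rewrite (_ : 4 = 2 ^+ 2 :> R); last by ring.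
  rewrite -exprM; apply: ler_weXn2l; first by lra.
  by have := median_far h; rewrite size_block_values.
rewrite iid_integralZ//.
- apply: le_trans (lee_wpmul2l _ prodle) _; first by rewrite lee_fin invr_ge0 exprn_ge0.
  rewrite -EFinM lee_fin mulrC -expr_div_n.
  by rewrite (_ : 7 / 4 / 2 = 7 / 8 :> R)//; field.
- exact: seq_measurable_prod_blocks.
- by move=> s; rewrite /block_values big_map; apply: prodr_ge0.
Qed.

(** The bound for all offsets [a] encodes mean [x] and variance at most [v] at once: a nonzero mean
    of [h b - x] would add a term linear in [a]. The average is then the sum of blocks with offset
    0, rescaled. *)
Lemma average_blocks_variance h m (v : R) J (x : R) : seq_measurable h -> 0 <= v ->
  (0 < J)%N ->
  (forall a : R, iid_integral P m (fun b => ((a + (h b - x)) ^+ 2)%R)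
     <= (a ^+ 2 + v)%:E)%E ->
  (iid_integral P (J * m)
     (fun s => ((average (block_values h J m s) - x) ^+ 2)%R) <= (v / J%:R)%:E)%E.
Proof.
move=> mh v0 J0 hv.
have mhx : seq_measurable (fun b => h b - x).
  by apply: (seq_measurableD mh); exact: seq_measurable_cst.
have J0' : J%:R != 0 :> R by rewrite pnatr_eq0 -lt0n.
rewrite (_ : (fun s => _) = (fun s => J%:R ^- 2 *
    (0 + \sum_(y <- block_values (fun b => h b - x) J m s) y) ^+ 2)); last first.
  apply/funext => s; rewrite add0r /average size_block_values /block_values.
  rewrite !big_map sumrB big_const_seq count_predT iter_addr_0 size_reshape_nseq.
  by rewrite -mulr_natr; field.
rewrite iid_integralZ//; last 2 first.
- apply: seq_measurable_sqr; apply: seq_measurableD.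
    exact: seq_measurable_cst.
  exact: seq_measurable_sum_blocks.
- by move=> s; exact: sqr_ge0.
apply: le_trans (lee_wpmul2l _ (iid_integral_sum_blocks J 0 mhx v0 hv)) _.
  by rewrite lee_fin invr_ge0 sqr_ge0.
rewrite -EFinM lee_fin le_eqVlt; apply/orP; left; apply/eqP.
by rewrite expr0n add0r; field.
Qed.

Variable Z : forall m : nat, {mfun m.-tuple X >-> R}.

(** The shifted variable [W] has mean [a] and the variance of [Z m], so its second moment is that
    variance plus [a ^+ 2]. *)
Lemma iid_integral_stat m (a s : R) : (Z m : _ -> R) \in Lfun (iid P m) 2%:E ->
  stddev Z P m <= s ->
  (iid_integral P m (fun b => ((a + (seq_stat Z b - mean Z P m)) ^+ 2)%R)
     <= (a ^+ 2 + s ^+ 2)%:E)%E.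
Proof.
move=> Z2 sds; set mu := mean Z P m; set W := (Z m : _ -> R) \+ cst (a - mu).
have Z1 : (Z m : _ -> R) \in Lfun (iid P m) 1.
  by apply: Lfun_subset12 => //; exact: fin_num_measure.
have W2 : W \in Lfun (iid P m) 2%:E.
  by rewrite rpredD ?lee1n//= => _; rewrite Lfun_cst.
have EW : ('E_(iid P m)[W] = a%:E)%E.
  rewrite expectationD//; last by rewrite Lfun_cst.
  rewrite expectation_cst -[X in (X + _)%E]fineK ?expectation_fin_num//.
  by rewrite -EFinD -/(mean Z P m) -/mu addrC subrK.
have -> : iid_integral P m (fun b => ((a + (seq_stat Z b - mu)) ^+ 2)%R) =
    ('E_(iid P m)[W ^+ 2])%E.
  rewrite unlock; apply: eq_integral => b _; rewrite seq_statE.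
  by rewrite expr2 fctE /W /=; congr (_ %:E); ring.
have VW : ('V_(iid P m)[W] = 'V_(iid P m)[Z m])%E by exact: varianceD_cst_r.
have Vfin : ('V_(iid P m)[Z m] \is a fin_num)%E by exact: variance_fin_num.
have E2 : ('E_(iid P m)[W ^+ 2] = 'V_(iid P m)[Z m] + (a ^+ 2)%:E)%E.
  by rewrite -VW varianceE// EW -EFin_expe subeK.
rewrite E2 addeC EFinD leeD2l// -(fineK Vfin) lee_fin.
have V0 : 0 <= fine 'V_(iid P m)[Z m]%E by rewrite fine_ge0// variance_ge0.
rewrite -[leLHS]sqr_sqrtr//.
by rewrite ler_sqr ?nnegrE ?sqrtr_ge0// (le_trans _ sds) ?sqrtr_ge0.
Qed.

End block_bounds.

(** * Ceilings, numerical constants and minimal batch sizes *)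

Section numeric.
Variable R : realType.
Implicit Types x u : R.

Lemma natceil_ge x : x <= (natceil x)%:R.
Proof.
have [x0|x0] := leP 0 x; last by rewrite (le_trans (ltW x0)).
rewrite /natceil natr_absz ger0_norm ?ceil_ge//.
by rewrite ceil_ge0; lra.
Qed.

Lemma natceil_le x : 0 <= x -> (natceil x)%:R <= x + 1.
Proof.
move=> x0; rewrite /natceil natr_absz ger0_norm ?ceil_ge0; last by lra.
by have := gt_pred_ceil x; rewrite intrB mulr1z; lra.
Qed.

(** Since [7 / 8 <= expR (- (1 / 8))], a multiple 8 of the logarithm suffices: this is the 8 in the
    number of stage 1 batches. *)
Lemma seven_eighths_expn x n : x <= 1 -> 0 < x ->
  (num_batches0 x <= n)%N -> (7 / 8) ^+ n <= x.
Proof.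
move=> x1 x0 nn.
have h : (7 / 8 : R) <= expR (- (1 / 8)) by apply: le_trans (expR_ge1Dx _); lra.
apply: (@le_trans _ _ (expR (- (1 / 8)) ^+ n)).
  by apply: lerXn2r => //; rewrite nnegrE ?expR_ge0//; lra.
rewrite -expRM_natl -[leRHS](lnK (x := x)) ?posrE// ler_expR.
have : 8 * ln x^-1 <= n%:R.
  by apply: le_trans (natceil_ge _) _; rewrite ler_nat.
by rewrite lnV ?posrE//; lra.
Qed.

(** This explains the factor 16 in [num_means]: 16 means gain a factor 8. The power is reached by
    repeated squaring, rounding up to short decimals. *)
Lemma seven_eighths_exp16 : (7 / 8 : R) ^+ 16 <= 8^-1.
Proof.
have h (y z : R) n : 0 <= y -> y ^+ n <= z -> y ^+ (n * 2) <= z ^+ 2.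
  move=> y0 yz; rewrite exprM; apply: lerXn2r => //; rewrite nnegrE ?exprn_ge0//.
  by rewrite (le_trans _ yz)// exprn_ge0.
have h0 : 0 <= 7 / 8 :> R by lra.
have h2 : (7 / 8 : R) ^+ 2 <= 766 / 1000 by lra.
have h4 : (7 / 8 : R) ^+ 4 <= 59 / 100 by apply: le_trans (h _ _ 2%N h0 h2) _; lra.
have h8 : (7 / 8 : R) ^+ 8 <= 35 / 100 by apply: le_trans (h _ _ 4%N h0 h4) _; lra.
by apply: le_trans (h _ _ 8%N h0 h8) _; lra.
Qed.

Lemma two_expn_num_rounds (rho : R) : 0 < rho -> 2 ^- num_rounds rho <= rho.
Proof.
move=> rho0; have := natceil_ge (ln rho^-1 / ln 2); rewrite -/(num_rounds rho).
have ln2 : 0 < ln 2 :> R by rewrite ln_gt0// ltr1n.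
rewrite ler_pdivrMr// mulr_natl -lnXn// ler_ln ?posrE ?invr_gt0 ?exprn_gt0//.
by move=> h; rewrite -[leRHS]invrK lef_pV2 ?posrE ?invr_gt0 ?exprn_gt0.
Qed.

Lemma batch_size_admissible m_min (f : nat -> R) u :
  admissible_sizes m_min f u !=set0 ->
  admissible_sizes m_min f u (batch_size m_min f u).
Proof.
move=> [m hm]; rewrite /batch_size.
suff /(xgetPex 0%N)[] : exists m, [set m | admissible_sizes m_min f u m /\
    forall m', admissible_sizes m_min f u m' -> (m <= m')%N] m by [].
have ex : exists m, `[< admissible_sizes m_min f u m >] by exists m; exact/asboolP.
exists (ex_minn ex); case: ex_minnP => k /asboolP hk kmin; split => // m' hm'.
by apply: kmin; exact/asboolP.
Qed.

End numeric.

(** * The tester on sequences and its measurability *)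

Section tester_measurability.
Context {d : measure_display} {X : measurableType d} {R : realType}.
Variable m_min : nat.
Variable Z : forall m : nat, {mfun m.-tuple X >-> R}.
Variables (tau0 tau1 : R) (sigma : nat -> R) (delta rho : R) (t : nat -> R).

Local Notation Delta := (gap tau0 tau1).
Local Notation K := (num_rounds rho).
Local Notation msize := (msize m_min tau0 tau1 sigma).
Local Notation cost := (cost m_min tau0 tau1 sigma rho t).
Local Notation cost0 := (cost0 m_min tau0 tau1 sigma delta).
Local Notation rounds := (rounds m_min Z tau0 tau1 sigma rho t).

Definition round_mean k (b : seq X) : R :=
  average (block_values (seq_stat Z) (num_batches t k) (msize (t k)) b).

Definition stage1_median (s : seq X) : R :=
  median (block_values (seq_stat Z) (num_batches0 delta) (msize (1 / 8)) s).

Definition round_median k (s : seq X) : R :=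
  median (block_values (round_mean k) (num_means rho k)
    (num_batches t k * msize (t k)) s).

Lemma round_medianE k s :
  median (round_means m_min Z tau0 tau1 sigma rho t k s) = round_median k s.
Proof. by rewrite /round_means map_reshape_reshape. Qed.

Lemma seq_measurable_round_mean k : seq_measurable (round_mean k).
Proof. by apply: seq_measurable_average_blocks; exact: seq_measurable_stat. Qed.

Lemma seq_measurable_round_median k : seq_measurable (round_median k).
Proof. by apply: seq_measurable_median_blocks; exact: seq_measurable_round_mean. Qed.

Lemma seq_measurable_stage1_median : seq_measurable stage1_median.
Proof. by apply: seq_measurable_median_blocks; exact: seq_measurable_stat. Qed.

Lemma round_median_cat k s1 s2 : size s1 = cost k ->
  round_median k (s1 ++ s2) = round_median k s1.
Proof.
move=> h; rewrite /round_median /block_values reshape_nseq_cat//.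
by rewrite h /cost mulnA.
Qed.

Lemma stage1_median_cat s1 s2 : size s1 = cost0 ->
  stage1_median (s1 ++ s2) = stage1_median s1.
Proof. by move=> h; rewrite /stage1_median /block_values reshape_nseq_cat. Qed.

Definition accept_at k r s : bool :=
  round_median k s <= tau0 + (r - 2 ^- k) * Delta.

Definition reject_at k r s : bool :=
  tau0 + (r + 2 ^- k) * Delta <= round_median k s.

Lemma rounds_cons k ks r s : rounds (k :: ks) r s =
  if accept_at k r s then (true, cost k)
  else if reject_at k r s then (false, cost k)
  else ((rounds ks r (drop (cost k) s)).1,
        (cost k + (rounds ks r (drop (cost k) s)).2)%N).
Proof. by rewrite /= round_medianE. Qed.

(** Freed from the fixed input length of [tester], so that it can be evaluated on a concatenation
    that is split at [cost0]. *)
Definition seq_tester r s : bool * nat :=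
  if stage1_median s < tau0 + Delta / 8 then (true, cost0)
  else if tau1 - Delta / 8 < stage1_median s then (false, cost0)
  else ((rounds (iota 1 K) r (drop cost0 s)).1,
        (cost0 + (rounds (iota 1 K) r (drop cost0 s)).2)%N).

Lemma testerE r s :
  tester m_min Z tau0 tau1 sigma delta rho t r s = seq_tester r s.
Proof. by []. Qed.

(** * Joint measurability in threshold and samples, over an arbitrary parameter space *)

Section measurable_in_parameters.
Context {d' : measure_display} {Y : measurableType d'}.
Variables (r : Y -> R) (n : nat) (s : Y -> n.-tuple X).
Hypotheses (mr : measurable_fun setT r) (ms : measurable_fun setT s).

Lemma measurable_seq_comp d2 (T : measurableType d2) o (G : seq X -> T) :
  seq_measurable G -> measurable_fun setT (fun y => G (drop o (s y))).
Proof.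
move=> mG; apply: (@measurableT_comp _ _ _ _ _ _
  (fun s : n.-tuple X => G (drop o s))) => //.
exact: (seq_measurable_drop o mG).
Qed.

Lemma measurable_accept_at k o :
  measurable_fun setT (fun y => accept_at k (r y) (drop o (s y))).
Proof.
apply: measurable_fun_ler.
  exact: (measurable_seq_comp o (seq_measurable_round_median k)).
apply: measurable_funD => //; apply: measurable_funM => //.
exact: measurable_funB.
Qed.

Lemma measurable_reject_at k o :
  measurable_fun setT (fun y => reject_at k (r y) (drop o (s y))).
Proof.
apply: measurable_fun_ler; last first.
  exact: (measurable_seq_comp o (seq_measurable_round_median k)).
apply: measurable_funD => //; apply: measurable_funM => //.
exact: measurable_funD.
Qed.

(** The offset [o] lets the induction over rounds keep the same tuple [s y] instead of passing to
    tuples of decreasing length. *)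
Lemma measurable_rounds1 ks o :
  measurable_fun setT (fun y => (rounds ks (r y) (drop o (s y))).1).
Proof.
elim: ks o => [|k ks IH] o; first exact: measurable_cst.
rewrite [X in measurable_fun _ X](_ : _ = (fun y =>
  if accept_at k (r y) (drop o (s y)) then true
  else if reject_at k (r y) (drop o (s y)) then false
  else (rounds ks (r y) (drop (cost k + o) (s y))).1)); last first.
  apply/funext => y; rewrite rounds_cons drop_drop.
  by case: ifP => // _; case: ifP.
apply: measurable_fun_ifT => //; first exact: measurable_accept_at.
by apply: measurable_fun_ifT => //; exact: measurable_reject_at.
Qed.

Lemma measurable_rounds2 ks o :
  measurable_fun setT (fun y => (rounds ks (r y) (drop o (s y))).2).
Proof.
elim: ks o => [|k ks IH] o; first exact: measurable_cst.
rewrite [X in measurable_fun _ X](_ : _ = (fun y =>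
  if accept_at k (r y) (drop o (s y)) then cost k
  else if reject_at k (r y) (drop o (s y)) then cost k
  else (cost k + (rounds ks (r y) (drop (cost k + o) (s y))).2)%N)); last first.
  apply/funext => y; rewrite rounds_cons drop_drop.
  by case: ifP => // _; case: ifP.
apply: measurable_fun_ifT => //; first exact: measurable_accept_at.
apply: measurable_fun_ifT => //; first exact: measurable_reject_at.
exact: measurable_fun_addn.
Qed.

Let measurable_stage1 : measurable_fun setT (fun y => stage1_median (s y)).
Proof.
apply: (eq_measurable_fun (fun y => stage1_median (drop 0 (s y)))).
  by move=> y _; rewrite drop0.
exact: (measurable_seq_comp 0 seq_measurable_stage1_median).
Qed.

Lemma measurable_seq_tester1 :
  measurable_fun setT (fun y => (seq_tester (r y) (s y)).1).
Proof.
rewrite [X in measurable_fun _ X](_ : _ = (fun y =>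
  if stage1_median (s y) < tau0 + Delta / 8 then true
  else if tau1 - Delta / 8 < stage1_median (s y) then false
  else (rounds (iota 1 K) (r y) (drop cost0 (s y))).1)); last first.
  by apply/funext => y; rewrite /seq_tester; case: ifP => // _; case: ifP.
apply: measurable_fun_ifT => //; first exact: measurable_fun_ltr.
apply: measurable_fun_ifT => //; first exact: measurable_fun_ltr.
exact: measurable_rounds1.
Qed.

Lemma measurable_seq_tester2 :
  measurable_fun setT (fun y => (seq_tester (r y) (s y)).2%:R : R).
Proof.
apply: (@measurableT_comp _ _ _ _ _ _ (fun k : nat => k%:R : R)) => //.
rewrite [X in measurable_fun _ X](_ : _ = (fun y =>
  if stage1_median (s y) < tau0 + Delta / 8 then cost0
  else if tau1 - Delta / 8 < stage1_median (s y) then cost0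
  else (cost0 + (rounds (iota 1 K) (r y) (drop cost0 (s y))).2)%N)); last first.
  by apply/funext => y; rewrite /seq_tester; case: ifP => // _; case: ifP.
apply: measurable_fun_ifT => //; first exact: measurable_fun_ltr.
apply: measurable_fun_ifT => //; first exact: measurable_fun_ltr.
by apply: measurable_fun_addn => //; exact: measurable_rounds2.
Qed.

End measurable_in_parameters.

Lemma seq_measurable_tester1 r : seq_measurable (fun s => (seq_tester r s).1).
Proof.
by move=> n; exact: (@measurable_seq_tester1 _ _ (cst r) n id).
Qed.

Lemma seq_measurable_rounds1 ks r : seq_measurable (fun s => (rounds ks r s).1).
Proof.
move=> n; apply: (eq_measurable_fun
    (fun s : n.-tuple X => (rounds ks r (drop 0 s)).1)).
  by move=> s _; rewrite drop0.
exact: (@measurable_rounds1 _ _ (cst r) n id).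
Qed.

End tester_measurability.

(** * Integration over the random threshold *)

Section random_threshold.
Variable R : realType.
Local Notation Q := (threshold_law R).

Lemma threshold_integralE (f : R -> \bar R) :
  measurable_fun setT f -> (forall r, 0 <= f r)%E ->
  (\int[Q]_r f r = 2%:E * \int[lebesgue_measure]_(r in `[(1 / 4)%R, (3 / 4)%R]) f r)%E.
Proof.
move=> mf f0; rewrite /threshold_law integral_uniform//.
by congr (_%:E * _)%E; field.
Qed.

Lemma le_threshold_integral (f g : R -> \bar R) :
  measurable_fun setT f -> measurable_fun setT g ->
  (forall r, 0 <= f r)%E -> (forall r, 0 <= g r)%E ->
  (forall r, (1 / 4 <= r <= 3 / 4)%R -> f r <= g r)%E ->
  (\int[Q]_r f r <= \int[Q]_r g r)%E.
Proof.
move=> mf mg f0 g0 fg; rewrite !threshold_integralE// lee_wpmul2l//.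
apply: ge0_le_integral => //.
- exact: measurable_funTS.
- exact: measurable_funTS.
Qed.

Lemma measurable_near (y w : R) : measurable_fun setT (fun r : R => `|y - r| < w).
Proof.
apply: measurable_fun_ltr => //.
by apply: measurableT_comp => //; exact: measurable_funB.
Qed.

(** The threshold has density 2 on its support, and the window has length [2 * w]. *)
Lemma threshold_near_le (y w : R) : 0 <= w ->
  (\int[Q]_r ((`|y - r| < w)%R%:R)%:E <= (4 * w)%:E)%E.
Proof.
move=> w0; pose A : set R := `]y - w, y + w[%classic.
have mA : measurable A by exact: measurable_itv.
rewrite threshold_integralE; last 2 first.
- by apply/measurable_EFinP; apply: measurable_indicator; exact: measurable_near.
- by move=> r; rewrite lee_fin.
rewrite (_ : (fun r => _) = (fun r => (\1_A r)%:E)); last first.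
  apply/funext => r; congr (_%:E); rewrite indicE; congr (_%:R); congr nat_of_bool.
  by apply/idP/idP; rewrite inE /A /= in_itv /= ltr_norml => /andP[h1 h2]; lra.
rewrite integral_indic//.
apply: (@le_trans _ _ (2%:E * lebesgue_measure A)%E).
  rewrite lee_wpmul2l// le_measure// ?inE//.
  by apply: measurableI => //; exact: measurable_itv.
rewrite lebesgue_measure_itv /= lte_fin; case: ifPn => _.
  by rewrite -EFinD -EFinM lee_fin; lra.
by rewrite mule0 lee_fin mulr_ge0.
Qed.

Lemma threshold_product_le d (Y : measurableType d) (M : probability Y R)
    (S : set (R * Y)) (b : R -> R) :
  measurable S -> measurable_fun setT b -> (forall r, 0 <= b r) ->
  (forall r, 1 / 4 <= r <= 3 / 4 -> (M (xsection S r) <= (b r)%:E)%E) ->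
  ((Q \x M) S <= \int[Q]_r (b r)%:E)%E.
Proof.
move=> mS mb b0 h.
apply: (@le_threshold_integral (fun r => M (xsection S r)) (fun r => (b r)%:E)) => //.
- exact: measurable_fun_xsection.
- exact/measurable_EFinP.
Qed.

Lemma sum_eighths_le n : \sum_(i < n) 8 ^- i * 2 ^+ i <= 2 :> R.
Proof.
(* The terms are [4 ^- i]; the subtracted remainder strengthens the bound so that it passes through
   the induction. *)
suff : \sum_(i < n) 8 ^- i * 2 ^+ i <= 2 - 2 * 4 ^- n :> R.
  by move/le_trans; apply; rewrite gerBl mulr_ge0// invr_ge0 exprn_ge0.
elim: n => [|n IH]; first by rewrite big_ord0 expr0 invr1 mulr1 subrr.
rewrite big_ord_recr /=.
have -> : 8 ^- n * 2 ^+ n = 4 ^- n :> R.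
  by rewrite -!exprVn -exprMn; congr (_ ^+ _); field.
have h : 0 <= 4 ^- n :> R by rewrite invr_ge0 exprn_ge0.
have -> : 4 ^- n.+1 = 4 ^- n / 4 :> R by rewrite exprS invfM mulrC.
by move: IH h; lra.
Qed.

End random_threshold.

(** * Testing a median [V], within [e] of the mean [m], against a threshold [T] with slack [e] *)

Section threshold_tests.
Variable R : realType.
Implicit Types V T m e : R.

Lemma lt_of_accept V T m e : V <= T - e -> `|V - m| < e -> m < T.
Proof. by move=> h; rewrite ltr_norml => /andP[? ?]; lra. Qed.

Lemma le_of_reject V T m e : T + e <= V -> `|V - m| < e -> T <= m.
Proof. by move=> h; rewrite ltr_norml => /andP[? ?]; lra. Qed.

Lemma near_of_undecided V T m e : T - e < V -> V < T + e -> `|V - m| < e ->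
  `|m - T| < 2 * e.
Proof.
by move=> h1 h2; rewrite !ltr_norml => /andP[? ?]; apply/andP; split; lra.
Qed.

End threshold_tests.

(** * Probability of deviating from the ideal verdict *)

Section tester_analysis.
Context {d : measure_display} {X : measurableType d} {R : realType}.
Variables (H : testing_problem X R) (m_min : nat).
Variable Z : forall m : nat, {mfun m.-tuple X >-> R}.
Variables (tau0 tau1 : R) (sigma : nat -> R) (delta rho : R) (t : nat -> R).

Local Notation Delta := (gap tau0 tau1).
Local Notation K := (num_rounds rho).
Local Notation sizes u := (admissible_sizes m_min (noise_ratio tau0 tau1 sigma) u).
Local Notation msize := (msize m_min tau0 tau1 sigma).
Local Notation cost := (cost m_min tau0 tau1 sigma rho t).
Local Notation cost0 := (cost0 m_min tau0 tau1 sigma delta).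
Local Notation rounds := (rounds m_min Z tau0 tau1 sigma rho t).
Local Notation stage1_median := (stage1_median m_min Z tau0 tau1 sigma delta).
Local Notation round_median := (round_median m_min Z tau0 tau1 sigma rho t).
Local Notation seq_tester := (seq_tester m_min Z tau0 tau1 sigma delta rho t).

Hypothesis Zgap : size_invariant_expectation_gap H m_min Z tau0 tau1 sigma.
Hypothesis tau01 : tau0 < tau1.
Hypothesis delta_gt0 : 0 < delta.
Hypothesis delta_le_rho : delta <= rho.
Hypothesis rho_le1 : rho <= 1.
Hypothesis t_bounds : forall k, (1 <= k <= K)%N -> 2 ^- k <= t k <= 1 / 2.
Hypothesis sizes_stage1 : sizes (1 / 8) !=set0.
Hypothesis sizes_round : forall k, (1 <= k <= K)%N -> sizes (t k) !=set0.

Let Delta_gt0 : 0 < Delta. Proof. by rewrite subr_gt0. Qed.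

Lemma num_batches_ge k : t k ^+ 2 * 2 ^+ (2 * k)%N <= (num_batches t k)%:R.
Proof. exact: natceil_ge. Qed.

Lemma t_scaled_ge1 k : (1 <= k <= K)%N -> 1 <= t k ^+ 2 * 2 ^+ (2 * k)%N.
Proof.
move=> /t_bounds/andP[tk _].
rewrite mulnC exprM -exprMn -[leLHS](expr1n _ 2); apply: lerXn2r; rewrite ?nnegrE//.
  rewrite mulr_ge0 ?exprn_ge0// (le_trans _ tk)// invr_ge0 exprn_ge0//.
by rewrite -ler_pdivrMr ?exprn_gt0// mul1r.
Qed.

Section sampling_distribution.
Variable P : probability X R.
Hypothesis HP : model H P.

(** The size [msize (1 / 8)] is only a representative: by size invariance the other batch sizes give
    the same mean. *)
Definition true_mean : R := mean Z P (msize (1 / 8)).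
Local Notation mu := true_mean.
(** How far the mean lies outside [[tau0, tau1]], in units of [Delta]; the standard deviation is
    allowed to grow by the factor [1 + excess]. *)
Definition excess : R :=
  Num.max 0 (Num.max ((mu - tau1) / Delta) ((tau0 - mu) / Delta)).

Lemma excess_ge0 : 0 <= excess. Proof. by rewrite /excess le_max lexx. Qed.

Lemma mean_msize u : sizes u !=set0 -> mean Z P (msize u) = mu.
Proof.
move=> /batch_size_admissible[h1 _]; have [h2 _] := batch_size_admissible sizes_stage1.
exact: (Zgap.2 P HP).
Qed.

Lemma stat_second_moment u (a : R) : sizes u !=set0 ->
  (iid_integral P (msize u) (fun b => (a + (seq_stat Z b - mu)) ^+ 2)%R
     <= (a ^+ 2 + (u / 2 * Delta * (1 + excess)) ^+ 2)%:E)%E.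
Proof.
move=> su; have [mu1 mu2] := batch_size_admissible su.
have [Z2 _ _ _ sd] := Zgap.1 _ mu1.
rewrite -(mean_msize su); apply: iid_integral_stat; first exact: Z2.
apply: le_trans (sd _ HP) _; rewrite (mean_msize su) -/Delta -/excess.
apply: ler_wpM2r; first by rewrite addr_ge0// excess_ge0.
by move: mu2; rewrite /noise_ratio ler_pdivrMr.
Qed.

(** The size for 1/8 bounds the standard deviation by [Delta * (1 + excess) / 16], half of the
    radius, as the median bound requires. *)
Lemma stage1_tail : (iid_integral P cost0
  (fun s => (Delta * (1 + excess) / 8 <= `|stage1_median s - mu|)%R%:R)
  <= delta%:E)%E.
Proof.
have e0 := excess_ge0.
apply: (@le_trans _ _ ((7 / 8) ^+ num_batches0 delta)%:E); last first.
  by rewrite lee_fin seven_eighths_expn// (le_trans delta_le_rho).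
apply: median_blocks_tail; first exact: seq_measurable_stat.
  by rewrite divr_gt0// mulr_gt0// ltr_pwDl.
have := stat_second_moment 0 sizes_stage1.
rewrite (_ : (fun b => _) = (fun b => (seq_stat Z b - mu) ^+ 2)); last first.
  by apply/funext => b; rewrite add0r.
move=> /le_trans; apply; rewrite lee_fin le_eqVlt; apply/orP; left; apply/eqP.
by rewrite expr0n /=; field.
Qed.

(** One batch has standard deviation at most [t k / 2 * Delta * (1 + excess)]. Averaging at least
    [t k ^+ 2 * 2 ^+ (2 * k)] batches brings this down to half of the radius, and each group of 16
    means contributes a factor 1/8. *)
Lemma round_tail k : (1 <= k <= K)%N -> (iid_integral P (cost k)
  (fun s => (2 ^- k * (Delta * (1 + excess)) <= `|round_median k s - mu|)%R%:R)
  <= (8 ^- (K - k + 1))%:E)%E.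
Proof.
move=> kK; have e0 := excess_ge0.
have D0 : 0 < Delta * (1 + excess) by rewrite mulr_gt0// ltr_pwDl.
have J1 : 1 <= (num_batches t k)%:R :> R.
  by apply: le_trans (num_batches_ge k); exact: t_scaled_ge1.
apply: (@le_trans _ _ ((7 / 8) ^+ num_means rho k)%:E); last first.
  rewrite lee_fin /num_means exprM -exprVn; apply: lerXn2r.
  - by rewrite nnegrE exprn_ge0//; lra.
  - by rewrite nnegrE invr_ge0.
  - exact: seven_eighths_exp16.
rewrite /cost -mulnA; apply: median_blocks_tail.
- exact: seq_measurable_round_mean.
- by rewrite mulr_gt0// invr_gt0 exprn_gt0.
apply: le_trans (@average_blocks_variance _ _ _ P _ _
  ((t k / 2 * Delta * (1 + excess)) ^+ 2) _ mu _ _ _ _) _.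
- exact: seq_measurable_stat.
- exact: sqr_ge0.
- by rewrite -(ltr_nat R) (lt_le_trans _ J1).
- by move=> a; exact: (stat_second_moment a (sizes_round kK)).
rewrite lee_fin ler_pdivrMr; last by rewrite (lt_le_trans _ J1).
rewrite -mulrA !exprMn [leLHS](_ : _ = t k ^+ 2 * ((Delta * (1 + excess)) ^+ 2 / 4)); last first.
  by field.
rewrite [leRHS](_ : _ = 2 ^- k ^+ 2 * (num_batches t k)%:R *
    ((Delta * (1 + excess)) ^+ 2 / 4)); last by field.
apply: ler_wpM2r; first by rewrite divr_ge0// sqr_ge0.
rewrite mulrC -ler_pdivrMr ?exprn_gt0 ?invr_gt0 ?exprn_gt0//.
by rewrite exprVn invrK -exprM mulnC num_batches_ge.
Qed.

Definition near_threshold r w : bool := `|mu - (tau0 + r * Delta)| < w * Delta.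

(* The verdict that both runs are compared with: it depends on the shared
   threshold [r] but not on the samples. *)
Definition ideal_verdict r : bool := mu < tau0 + r * Delta.

Definition wrong_rounds ks r s : bool := (rounds ks r s).1 != ideal_verdict r.

Lemma seq_measurable_wrong_rounds ks r :
  seq_measurable (fun s => (wrong_rounds ks r s)%:R : R).
Proof.
apply: seq_measurable_bool; apply: (@seq_measurable_neq _ _ (fun s => (rounds ks r s).1)).
exact: seq_measurable_rounds1.
Qed.

(** The index counts from the end: [i = 0] is the final default acceptance, with full weight 1, and
    [i >= 1] is round [k = K + 1 - i], whose median is bad with probability at most [8 ^- i]. The
    radius equals [2 * 2 ^- (k - 1)]: unless the mean is that close to the threshold, a good median
    in round [k - 1] has already decided. *)
Definition rounds_failure r n : R :=
  \sum_(i < n.+1) 8 ^- i * (near_threshold r (2 * 2 ^- K * 2 ^+ i))%:R.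

Lemma rounds_failure_ge0 r n : 0 <= rounds_failure r n.
Proof. by apply: sumr_ge0 => i _; rewrite mulr_ge0// invr_ge0 exprn_ge0. Qed.

(** Induction on the number [n] of rounds left. A good median in the current round decides as the
    ideal verdict does, or leaves the round undecided and certifies the nearness assumed for the
    rounds after it. *)
Lemma wrong_rounds_le r n : excess = 0 -> (n <= K)%N ->
  near_threshold r (2 * 2 ^- K * 2 ^+ n) ->
  (iid_integral P (\sum_(K - n + 1 <= k < K.+1) cost k)
     (fun s => (wrong_rounds (iota (K - n + 1) n) r s)%:R)
   <= (rounds_failure r n)%:E)%E.
Proof.
move=> ex0; elim: n => [|n IH] nK near.
  (* With no round left the default acceptance may be wrong, so the full weight 1 is paid. *)
  rewrite /rounds_failure big_ord1 expr0 invr1 mul1r near.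
  rewrite -(iid_integral_cst P (\sum_(K - 0 + 1 <= k < K.+1) cost k) 1).
  apply: le_iid_integral => //.
  by move=> s _ /=; rewrite lern1 leq_b1.
set k := (K - n.+1 + 1)%N; have kE : k.+1 = (K - n + 1)%N by rewrite /k; lia.
have kK : (1 <= k <= K)%N by rewrite /k; lia.
rewrite big_ltn; last by lia.
rewrite /= kE.
have pow : 2 ^- k = 2 ^- K * 2 ^+ n :> R.
  have -> : K = (k + n)%N by rewrite /k; lia.
  by rewrite exprD invfM mulrAC -mulrA mulfV ?mulr1// expf_neq0.
pose bad s : R := (2 ^- k * (Delta * (1 + excess)) <= `|round_median k s - mu|)%R%:R.
have mbad : seq_measurable bad.
  apply: seq_measurable_bool; apply: seq_measurable_far.
  exact: seq_measurable_round_median.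
have mw ks : seq_measurable (fun s => (wrong_rounds ks r s)%:R : R).
  exact: seq_measurable_wrong_rounds.
have badle : (iid_integral P (cost k) bad <= (8 ^- n.+1)%:E)%E.
  by have := round_tail kK; rewrite (_ : (K - k + 1)%N = n.+1)//; rewrite /k; lia.
have split_le s1 s2 : size s1 = cost k ->
    (wrong_rounds (k :: iota (K - n + 1) n) r (s1 ++ s2))%:R <= bad s1 +
      (near_threshold r (2 * 2 ^- K * 2 ^+ n))%:R *
      (wrong_rounds (iota (K - n + 1) n) r s2)%:R :> R.
  move=> s1k; rewrite /wrong_rounds rounds_cons /accept_at /reject_at.
  rewrite round_median_cat// drop_size_cat// /bad ex0 addr0 mulr1 /ideal_verdict.
  rewrite /near_threshold -[2 * _ * _]mulrA -pow.
  have [far|close] := leP (2 ^- k * Delta) `|round_median k s1 - mu|.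
    by rewrite (le_trans (_ : _ <= 1)) ?lern1 ?leq_b1// lerDl mulr_ge0.
  rewrite mulrBl mulrDl !addrA.
  have [acc|acc] := leP (round_median k s1) _; rewrite /=.
    by rewrite (lt_of_accept acc close) add0r mulr_ge0.
  have [rej|rej] := leP _ (round_median k s1); rewrite /=.
    by rewrite ltNge (le_of_reject rej close) add0r mulr_ge0.
  by rewrite -mulrA (near_of_undecided acc rej close) add0r mul1r.
have -> : rounds_failure r n.+1 = 8 ^- n.+1 + rounds_failure r n.
  by rewrite /rounds_failure big_ord_recr /= near mulr1 addrC.
(* Nearness depends on [r] alone and not on the samples. If it fails, only a bad median can lead
   past this round, and the later rounds are charged nothing. *)
have [nn|nn] := boolP (near_threshold r (2 * 2 ^- K * 2 ^+ n)).
  rewrite -[rounds_failure r n]mul1r.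
  apply: (@iid_integral_cat_leD _ _ _ _ _ _ _ bad
    (fun s => (wrong_rounds (iota (K - n + 1) n) r s)%:R)) => //.
  - exact: rounds_failure_ge0.
  - by move=> s1 s2 h1 _; have := split_le s1 s2 h1; rewrite nn.
  - by apply: IH => //; lia.
apply: (@le_trans _ _ (8 ^- n.+1 + 0 * 0)%:E); last first.
  by rewrite lee_fin mul0r lerD2l rounds_failure_ge0.
apply: (@iid_integral_cat_leD _ _ _ _ _ _ _ bad (fun=> 0)) => //.
- by move=> s1 s2 h1 _; have := split_le s1 s2 h1; rewrite (negbTE nn) !mul0r.
- by rewrite iid_integral_cst.
Qed.

Local Notation budget := (sample_budget m_min tau0 tau1 sigma delta rho t).

Lemma excess_low : mu <= tau0 -> Delta * excess = tau0 - mu.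
Proof.
move=> h; have t01 := tau01.
have i : (mu - tau1) / Delta <= (tau0 - mu) / Delta.
  by rewrite ler_pM2r ?invr_gt0//; lra.
have j : 0 <= (tau0 - mu) / Delta by apply: divr_ge0; [lra|exact: ltW].
by rewrite /excess (max_r i) (max_r j) mulrC divfK// gt_eqF.
Qed.

Lemma excess_high : tau1 <= mu -> Delta * excess = mu - tau1.
Proof.
move=> h; have t01 := tau01.
have i : (tau0 - mu) / Delta <= (mu - tau1) / Delta.
  by rewrite ler_pM2r ?invr_gt0//; lra.
have j : 0 <= (mu - tau1) / Delta by apply: divr_ge0; [lra|exact: ltW].
by rewrite /excess (max_l i) (max_r j) mulrC divfK// gt_eqF.
Qed.

Lemma excess_mid : tau0 <= mu <= tau1 -> excess = 0.
Proof.
move=> /andP[h1 h2]; rewrite /excess max_l// ge_max.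
by rewrite !ler_pdivrMr// !mul0r; apply/andP; split; lra.
Qed.

Definition stage1_far s : bool :=
  Delta * (1 + excess) / 8 <= `|stage1_median s - mu|.

(** The tail radius exceeds [Delta / 8] by only an eighth of [tau0 - mu], while the cutoff is
    farther from the mean by all of [tau0 - mu]. *)
Lemma stage1_accepts r s : mu <= tau0 -> ~~ stage1_far s ->
  (seq_tester r s).1 = true.
Proof.
move=> m0; have h := excess_low m0; rewrite /stage1_far -ltNge mulrDr mulr1 h ltr_norml.
by move=> /andP[_ h2]; rewrite /seq_tester ifT//; lra.
Qed.

Lemma stage1_rejects r s : tau1 <= mu -> ~~ stage1_far s ->
  (seq_tester r s).1 = false.
Proof.
move=> m0; have h := excess_high m0; rewrite /stage1_far -ltNge mulrDr mulr1 h ltr_norml.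
move=> /andP[h2 _]; have t01 := tau01; rewrite /seq_tester.
have -> : tau1 - Delta / 8 < stage1_median s by lra.
rewrite ifF//; apply/negbTE; rewrite -leNgt.
by rewrite /gap in h2 *; lra.
Qed.

Lemma seq_measurable_stage1_far : seq_measurable (fun s => (stage1_far s)%:R : R).
Proof.
apply: seq_measurable_bool; apply: seq_measurable_far.
exact: seq_measurable_stage1_median.
Qed.

Lemma seq_measurable_tester_neq r c :
  seq_measurable (fun s => ((seq_tester r s).1 != c)%:R : R).
Proof.
apply: seq_measurable_bool; apply: (@seq_measurable_neq _ _ (fun s => (seq_tester r s).1)).
exact: seq_measurable_tester1.
Qed.

Lemma stage1_decides_le r c :
  (forall s, ~~ stage1_far s -> (seq_tester r s).1 = c) ->
  (iid_integral P budget (fun s => ((seq_tester r s).1 != c)%:R) <= delta%:E)%E.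
Proof.
move=> h; apply: (@le_trans _ _ (delta + 0 * 0)%:E); last by rewrite mul0r addr0.
apply: (@iid_integral_cat_leD _ _ _ _ _ _ _ (fun s => (stage1_far s)%:R) (fun=> 0)) => //.
- exact: seq_measurable_tester_neq.
- exact: seq_measurable_stage1_far.
- move=> s1 s2 h1 h2; rewrite mulr0 addr0.
  have [//|far] := boolP (stage1_far s1); first by rewrite lern1 leq_b1.
  rewrite (h (s1 ++ s2)) ?eqxx//.
  by move: far; rewrite /stage1_far stage1_median_cat.
- exact: stage1_tail.
- by rewrite iid_integral_cst.
Qed.

(** At [i = K] the radius is [2 * Delta], so the induction over rounds starts without any condition
    on [r] beyond its support. *)
Lemma near_threshold_full r : 1 / 4 <= r <= 3 / 4 -> tau0 <= mu <= tau1 ->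
  near_threshold r (2 * 2 ^- K * 2 ^+ K).
Proof.
move=> /andP[r1 r2] /andP[h1 h2]; have D0 := Delta_gt0; rewrite /near_threshold.
rewrite -mulrA mulVf ?expf_neq0// mulr1 ltr_norml.
have h3 : 0 <= (r - 1 / 4) * Delta by rewrite mulr_ge0//; lra.
have h4 : 0 <= (3 / 4 - r) * Delta by rewrite mulr_ge0//; lra.
by rewrite !mulrBl in h3 h4; apply/andP; rewrite /gap in D0 h3 h4 *; split; lra.
Qed.

(** For a mean outside [[tau0, tau1]] stage 1 alone reaches the ideal verdict up to probability
    [delta]; inside, [excess] is zero and the rounds are added by the union bound. *)
Lemma tester_wrong_le r : 1 / 4 <= r <= 3 / 4 ->
  (iid_integral P budget (fun s => ((seq_tester r s).1 != ideal_verdict r)%:R)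
   <= (delta + rounds_failure r K)%:E)%E.
Proof.
move=> r14; have B0 := rounds_failure_ge0 r K.
have D0 := Delta_gt0.
have rD : Delta / 4 <= r * Delta <= 3 * Delta / 4.
  have /andP[r1 r2] := r14.
  have h3 : 0 <= (r - 1 / 4) * Delta by rewrite mulr_ge0//; lra.
  have h4 : 0 <= (3 / 4 - r) * Delta by rewrite mulr_ge0//; lra.
  by rewrite !mulrBl in h3 h4; apply/andP; split; lra.
have t01 := tau01; have small c : (forall s, ~~ stage1_far s -> (seq_tester r s).1 = c) ->
    ideal_verdict r = c ->
    (iid_integral P budget (fun s => ((seq_tester r s).1 != ideal_verdict r)%:R)
     <= (delta + rounds_failure r K)%:E)%E.
  move=> h ->; apply: le_trans (stage1_decides_le h) _.
  by rewrite lee_fin lerDl.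
have [m0|m0] := ltP mu tau0.
  apply: (small true) => [s|]; first by apply: stage1_accepts; exact: ltW.
  by rewrite /ideal_verdict; case/andP: rD; lra.
have [m1|m1] := ltP tau1 mu.
  apply: (small false) => [s|]; first by apply: stage1_rejects; exact: ltW.
  apply/negbTE; rewrite /ideal_verdict -leNgt; case/andP: rD.
  by rewrite /gap in D0 *; lra.
have mid : tau0 <= mu <= tau1 by rewrite m0.
have ex0 := excess_mid mid.
have rounds_le := wrong_rounds_le ex0 (leqnn K) (near_threshold_full r14 mid).
rewrite subnn add0n in rounds_le.
rewrite -[rounds_failure r K]mul1r.
apply: (@iid_integral_cat_leD _ _ _ _ _ _ _ (fun s => (stage1_far s)%:R)
  (fun s => (wrong_rounds (iota 1 K) r s)%:R)) => //.
- exact: seq_measurable_tester_neq.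
- exact: seq_measurable_stage1_far.
- exact: seq_measurable_wrong_rounds.
- move=> s1 s2 h1 h2; rewrite mul1r.
  have [far|far] := boolP (stage1_far s1).
    by rewrite (le_trans (_ : _ <= 1)) ?lern1 ?leq_b1// lerDl.
  rewrite add0r /seq_tester stage1_median_cat// drop_size_cat//.
  move: far; rewrite /stage1_far ex0 addr0 mulr1 -ltNge ltr_norml => /andP[f1 f2].
  (* A cutoff at [Delta / 8] from an endpoint and a median error below [Delta / 8] place the mean
     within [Delta / 4] of that endpoint or beyond it, hence on the right side of every threshold
     with [r] in [[1/4, 3/4]]. *)
  have [M1|M1] := ltP (stage1_median s1) _ => /=.
    rewrite (_ : ideal_verdict r = true)//.
    by rewrite /ideal_verdict; case/andP: rD; lra.
  have [M2|M2] := ltP _ (stage1_median s1) => //=.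
  rewrite (_ : ideal_verdict r = false)//.
  apply/negbTE; rewrite /ideal_verdict -leNgt; case/andP: rD.
  by rewrite /gap in M2 f1 f2 D0 *; lra.
- exact: stage1_tail.
Qed.

Lemma near_thresholdE r w : near_threshold r w = (`|(mu - tau0) / Delta - r| < w).
Proof.
have -> : (mu - tau0) / Delta - r = (mu - (tau0 + r * Delta)) / Delta.
  by field; rewrite gt_eqF.
by rewrite normrM [X in _ * X]gtr0_norm ?invr_gt0// ltr_pdivrMr.
Qed.

Lemma measurable_near_threshold w :
  measurable_fun setT (fun r => (near_threshold r w)%:R : R).
Proof.
apply: measurable_indicator; under eq_fun do rewrite near_thresholdE.
exact: measurable_near.
Qed.

Lemma measurable_rounds_failure n :
  measurable_fun setT (fun r => rounds_failure r n).
Proof.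
apply: measurable_sum => i; apply: measurable_funM => //.
exact: measurable_near_threshold.
Qed.

(** The constant is 1 + 16: [delta] costs at most [rho], and the windows cost [8 * 2 ^- K] times a
    series bounded by 2, with [2 ^- K <= rho]. *)
Lemma rounds_failure_integral_le :
  (\int[threshold_law R]_r (delta + rounds_failure r K)%:E <= (17 * rho)%:E)%E.
Proof.
have c0 : 0 <= 2 ^- K :> R by rewrite invr_ge0 exprn_ge0.
have crho : 2 ^- K <= rho.
  by apply: two_expn_num_rounds; exact: lt_le_trans delta_le_rho.
under eq_integral do rewrite EFinD.
rewrite ge0_integralD//; last 3 first.
- by move=> r _; rewrite lee_fin ltW.
- by move=> r _; rewrite lee_fin rounds_failure_ge0.
- by apply/measurable_EFinP; exact: measurable_rounds_failure.
rewrite integral_cst//= probability_setT mule1.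
under eq_integral do rewrite /rounds_failure -sumEFin.
rewrite ge0_integral_sum//; last first.
  move=> i; apply/measurable_EFinP; apply: measurable_funM => //.
  exact: measurable_near_threshold.
apply: (@le_trans _ _ (delta%:E +
    \sum_(i < K.+1) (8 ^- i * (4 * (2 * 2 ^- K * 2 ^+ i)))%:E)%E).
  rewrite leeD2l//; apply: lee_sum => i _.
  under eq_integral do rewrite EFinM.
  rewrite ge0_integralZl//; last first.
    by apply/measurable_EFinP; exact: measurable_near_threshold.
  rewrite EFinM lee_wpmul2l ?lee_fin ?invr_ge0 ?exprn_ge0//.
  under eq_integral do rewrite near_thresholdE.
  by apply: threshold_near_le; rewrite !mulr_ge0 ?exprn_ge0.
rewrite sumEFin -EFinD lee_fin.
rewrite (eq_bigr (fun i : 'I_K.+1 => 8 * 2 ^- K * (8 ^- i * 2 ^+ i))); last first.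
  by move=> i _; ring.
rewrite -mulr_sumr; have := sum_eighths_le R K.+1.
move: (\sum_(i < _) _) => S S2; move: c0 crho; move: (2 ^- K) => c c0 crho.
have : 8 * c * S <= 8 * c * 2 by rewrite ler_wpM2l// mulr_ge0.
by have := delta_le_rho; lra.
Qed.

End sampling_distribution.
End tester_analysis.

(** * Expected and worst-case sample counts *)

Section sample_cost.
Context {d : measure_display} {X : measurableType d} {R : realType}.
Variable m_min : nat.
Variable Z : forall m : nat, {mfun m.-tuple X >-> R}.
Variables (tau0 tau1 : R) (sigma : nat -> R) (delta rho : R) (t : nat -> R).

Local Notation Delta := (gap tau0 tau1).
Local Notation K := (num_rounds rho).
Local Notation msize := (msize m_min tau0 tau1 sigma).
Local Notation cost := (cost m_min tau0 tau1 sigma rho t).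
Local Notation cost0 := (cost0 m_min tau0 tau1 sigma delta).
Local Notation rounds := (rounds m_min Z tau0 tau1 sigma rho t).
Local Notation round_median := (round_median m_min Z tau0 tau1 sigma rho t).
Local Notation seq_tester := (seq_tester m_min Z tau0 tau1 sigma delta rho t).
Local Notation Q := (threshold_law R).

Hypothesis tau01 : tau0 < tau1.
Hypothesis t_bounds : forall k, (1 <= k <= K)%N -> 2 ^- k <= t k <= 1 / 2.

Let Delta_gt0 : 0 < Delta. Proof. by rewrite subr_gt0. Qed.

Lemma rounds_cost_le ks r s : ((rounds ks r s).2 <= \sum_(k <- ks) cost k)%N.
Proof.
elim: ks s => [//|k ks IH] s; rewrite rounds_cons big_cons.
by case: ifP => _ /=; [exact: leq_addr|case: ifP => _ /=; rewrite ?leq_addr ?leq_add2l].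
Qed.

Lemma tester_cost_le r s :
  ((seq_tester r s).2 <= cost0 + (rounds (iota 1 K) r (drop cost0 s)).2)%N.
Proof. by rewrite /seq_tester; case: ifP => _ /=; [|case: ifP => _ /=]; rewrite ?leq_addr. Qed.

(** Rounding up at most doubles the number of batches, because [t k >= 2 ^- k] makes the rounded
    quantity at least 1; hence 32 = 16 * 2. *)
Lemma cost_le k : (1 <= k <= K)%N ->
  (cost k)%:R <= 32 * (2 ^+ (2 * k)%N * (K - k + 1)%N%:R * t k ^+ 2 *
    (msize (t k))%:R) :> R.
Proof.
move=> kK; have h1 := t_scaled_ge1 t_bounds kK.
have h2 : (num_batches t k)%:R <= t k ^+ 2 * 2 ^+ (2 * k)%N + 1.
  by apply: natceil_le; exact: le_trans h1.
rewrite /cost /num_means !natrM.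
have h3 : (num_batches t k)%:R <= 2 * (t k ^+ 2 * 2 ^+ (2 * k)%N).
  by apply: le_trans h2 _; rewrite mulr_natl mulr2n lerD2l.
rewrite [leRHS](_ : _ = 16 * (K - k + 1)%N%:R * (2 * (t k ^+ 2 * 2 ^+ (2 * k)%N)) *
  (msize (t k))%:R); last by ring.
by apply: ler_wpM2r => //; apply: ler_wpM2l => //; rewrite mulr_ge0.
Qed.

Lemma undecided_near k r s : ~~ accept_at m_min Z tau0 tau1 sigma rho t k r s ->
  ~~ reject_at m_min Z tau0 tau1 sigma rho t k r s ->
  `|(round_median k s - tau0) / Delta - r| < 2 ^- k.
Proof.
rewrite /accept_at /reject_at -!ltNge mulrBl mulrDl => h1 h2.
have -> : (round_median k s - tau0) / Delta - r =
    (round_median k s - (tau0 + r * Delta)) / Delta.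
  by field; rewrite gt_eqF.
rewrite normrM [X in _ * X]gtr0_norm ?invr_gt0// ltr_pdivrMr// ltr_norml.
move: h1 h2; move: (2 ^- k * Delta) (r * Delta) (round_median k s) => e rD V h1 h2.
by apply/andP; split; lra.
Qed.

Lemma measurable_rounds_cost ks s :
  measurable_fun setT (fun r : R => (rounds ks r s).2%:R : R).
Proof.
apply: (@measurableT_comp _ _ _ _ _ _ (fun k : nat => k%:R : R)) => //.
apply: (eq_measurable_fun (fun r => (rounds ks r (drop 0 (in_tuple s))).2)).
  by move=> r _; rewrite drop0.
exact: (@measurable_rounds2 _ _ _ _ _ _ _ _ _ _ _ _ id _ (cst (in_tuple s))).
Qed.

(* The median of round [k] does not depend on the threshold, so for every fixed
   sample the threshold leaves round [k] undecided with probability at most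
   [4 * 2 ^- k]. *)
Lemma rounds_cost_integral_le n k (b : R -> bool) s :
  measurable_fun setT b ->
  (\int[Q]_r ((b r)%:R)%:E <= (8 * 2 ^- k)%:E)%E ->
  (\int[Q]_r ((b r)%:R * (rounds (iota k n) r s).2%:R)%:E <=
    (\sum_(j <- iota k n) 8 * 2 ^- j * (cost j)%:R)%:E)%E.
Proof.
elim: n k b s => [|n IH] k b s mb hb.
  rewrite big_nil; under eq_integral do rewrite /= mulr0.
  by rewrite integral0.
pose b' r := `|(round_median k s - tau0) / Delta - r| < 2 ^- k.
have mb' : measurable_fun setT b' by exact: measurable_near.
(* The bound [4 * 2 ^- k] is rewritten as [8 * 2 ^- k.+1]: the indicator that round [k] stays
   undecided plays for round [k.+1] the role that [b] plays for round [k]. *)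
have hb' : (\int[Q]_r ((b' r)%:R)%:E <= (8 * 2 ^- k.+1)%:E)%E.
  apply: le_trans (threshold_near_le _ _) _; first by rewrite invr_ge0 exprn_ge0.
  rewrite lee_fin le_eqVlt; apply/orP; left; apply/eqP.
  by rewrite exprS; field; rewrite expf_neq0.
pose f r : R := (b' r)%:R * (rounds (iota k.+1 n) r (drop (cost k) s)).2%:R.
have {}IH : (\int[Q]_r (f r)%:E <=
    (\sum_(j <- iota k.+1 n) 8 * 2 ^- j * (cost j)%:R)%:E)%E by exact: IH.
have mf : measurable_fun setT (fun r => (f r)%:E).
  apply/measurable_EFinP; apply: measurable_funM; first exact: measurable_indicator.
  exact: measurable_rounds_cost.
have mc : measurable_fun setT (fun r => ((cost k)%:R * (b r)%:R)%:E : \bar R).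
  apply/measurable_EFinP; apply: measurable_funM => //.
  exact: measurable_indicator.
apply: (@le_trans _ _ (\int[Q]_r (((cost k)%:R * (b r)%:R)%:E + (f r)%:E))%E).
  apply: ge0_le_integral => //.
  - apply/measurable_EFinP; apply: measurable_funM; first exact: measurable_indicator.
    exact: measurable_rounds_cost.
  - exact: emeasurable_funD.
  - move=> r _; rewrite -EFinD lee_fin (_ : iota k n.+1 = k :: iota k.+1 n)// rounds_cons.
    have f0 : 0 <= f r by rewrite /f mulr_ge0.
    case: ifPn => [_|acc] /=; first by rewrite mulrC lerDl.
    case: ifPn => [_|rej] /=; first by rewrite mulrC lerDl.
    rewrite natrD mulrDr mulrC lerD2l /f /b' (undecided_near acc rej) mul1r.
    by rewrite ler_piMl// lern1 leq_b1.
rewrite ge0_integralD//; last first.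
  by move=> r _; rewrite lee_fin mulr_ge0.
rewrite big_cons EFinD; apply: leeD; last exact: IH.
under eq_integral do rewrite EFinM.
rewrite ge0_integralZl//; last first.
  by apply/measurable_EFinP; exact: measurable_indicator.
by rewrite [X in (_ <= X%:E)%E]mulrC EFinM lee_wpmul2l.
Qed.

Lemma tester_cost_integral_le s :
  (\int[Q]_r ((seq_tester r s).2%:R)%:E <=
    (cost0%:R + \sum_(j <- iota 1 K) 8 * 2 ^- j * (cost j)%:R)%:E)%E.
Proof.
apply: (@le_trans _ _ (\int[Q]_r ((cost0%:R)%:E +
    ((true : bool)%:R * (rounds (iota 1 K) r (drop cost0 s)).2%:R)%:E))%E).
  apply: ge0_le_integral => //.
  - apply/measurable_EFinP.
    exact: (@measurable_seq_tester2 _ _ _ _ _ _ _ _ _ _ _ _ _ id _ (cst (in_tuple s))).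
  - apply: emeasurable_funD => //; apply/measurable_EFinP; apply: measurable_funM => //.
    exact: measurable_rounds_cost.
  - by move=> r _; rewrite -EFinD lee_fin mul1r -natrD ler_nat tester_cost_le.
rewrite ge0_integralD//; last first.
  apply/measurable_EFinP; apply: measurable_funM => //.
  exact: measurable_rounds_cost.
rewrite integral_cst//= probability_setT mule1 EFinD leeD2l//.
(* Round 1 has no predecessor; the constant indicator is admissible because [8 * 2 ^- 1] is at least
   1. *)
apply: (@rounds_cost_integral_le K 1 (fun=> true)) => //.
rewrite integral_cst//= probability_setT mule1 lee_fin; lra.
Qed.

(** Rounding up adds at most one batch. This is absorbed by [ln delta^-1] only while [delta] stays
    away from 1, which is how [delta_max] enters the constant. *)
Lemma cost0_le (delta_max C : R) : 0 < delta -> delta <= delta_max ->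
  delta_max < 1 -> 8 + (ln delta_max^-1)^-1 <= C ->
  cost0%:R <= C * ((msize (1 / 8))%:R * ln delta^-1).
Proof.
move=> d0 dm m1 hC.
have m0 : 0 < delta_max by exact: lt_le_trans dm.
have lm0 : 0 < ln delta_max^-1 by rewrite ln_gt0// invf_gt1.
have lml : ln delta_max^-1 <= ln delta^-1.
  by rewrite ler_ln ?posrE ?invr_gt0// lef_pV2.
have l0 : 0 < ln delta^-1 by exact: lt_le_trans lml.
rewrite /cost0 natrM [leRHS](_ : _ = C * ln delta^-1 * (msize (1 / 8))%:R); last by ring.
apply: ler_wpM2r => //.
apply: le_trans (natceil_le _) _; first by rewrite mulr_ge0// ltW.
apply: (@le_trans _ _ ((8 + (ln delta_max^-1)^-1) * ln delta^-1)).
  by rewrite [leRHS]mulrDl lerD2l mulrC ler_pdivlMr// mul1r.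
by rewrite ler_pM2r.
Qed.

Lemma worst_case_cost_le (delta_max C : R) : 0 < delta -> delta <= delta_max ->
  delta_max < 1 -> 256 + (ln delta_max^-1)^-1 <= C ->
  (sample_budget m_min tau0 tau1 sigma delta rho t)%:R
    <= C * worst_case_bound m_min tau0 tau1 sigma delta rho t.
Proof.
move=> d0 dm m1 hC; rewrite /sample_budget natrD /worst_case_bound mulrDr.
have m0 : 0 < delta_max by exact: lt_le_trans dm.
have lm0 : 0 < (ln delta_max^-1)^-1 by rewrite invr_gt0 ln_gt0// invf_gt1.
apply: lerD; first by apply: (@cost0_le delta_max) => //; lra.
rewrite natr_sum mulr_sumr !big_nat; apply: ler_sum => k kK.
apply: le_trans (@cost_le k kK) _.
apply: ler_wpM2r; last by lra.
by apply: mulr_ge0 => //; apply: mulr_ge0; [apply: mulr_ge0|exact: sqr_ge0].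
Qed.

(** The constant 256 is 8 * 32: the factor 8 from the probability of reaching a round, 32 from its
    cost. The reaching probability turns [2 ^+ (2 * k)] into [2 ^+ k]. *)
Lemma expected_cost_le (delta_max C : R) : 0 < delta -> delta <= delta_max ->
  delta_max < 1 -> 256 + (ln delta_max^-1)^-1 <= C ->
  cost0%:R + \sum_(j <- iota 1 K) 8 * 2 ^- j * (cost j)%:R
    <= C * expected_bound m_min tau0 tau1 sigma delta rho t.
Proof.
move=> d0 dm m1 hC; rewrite /expected_bound mulrDr.
have m0 : 0 < delta_max by exact: lt_le_trans dm.
have lm0 : 0 < (ln delta_max^-1)^-1 by rewrite invr_gt0 ln_gt0// invf_gt1.
apply: lerD; first by apply: (@cost0_le delta_max) => //; lra.
rewrite mulr_sumr (_ : iota 1 K = index_iota 1 K.+1); last first.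
  by rewrite /index_iota subn1.
rewrite !big_nat; apply: ler_sum => k kK.
have p0 : 0 <= 8 * 2 ^- k :> R by rewrite mulr_ge0// invr_ge0 exprn_ge0.
apply: le_trans (ler_wpM2l p0 (@cost_le k kK)) _.
rewrite [leLHS](_ : _ = 256 * (2 ^+ k * (K - k + 1)%N%:R * t k ^+ 2 * (msize (t k))%:R)); last first.
  rewrite mul2n -addnn exprD; field.
  by rewrite expf_neq0.
apply: ler_wpM2r; last by lra.
by apply: mulr_ge0 => //; apply: mulr_ge0; [apply: mulr_ge0|exact: sqr_ge0].
Qed.

End sample_cost.

(** * Success, replicability and sample complexity of the tester *)

Section tester_guarantees.
Context {d : measure_display} {X : measurableType d} {R : realType}.
Variables (H : testing_problem X R) (m_min : nat).
Variable Z : forall m : nat, {mfun m.-tuple X >-> R}.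
Variables (tau0 tau1 : R) (sigma : nat -> R) (delta rho : R) (t : nat -> R).

Local Notation K := (num_rounds rho).
Local Notation sizes u := (admissible_sizes m_min (noise_ratio tau0 tau1 sigma) u).
Local Notation msize := (msize m_min tau0 tau1 sigma).
Local Notation seq_tester := (seq_tester m_min Z tau0 tau1 sigma delta rho t).
Local Notation budget := (sample_budget m_min tau0 tau1 sigma delta rho t).
Local Notation Q := (threshold_law R).
Local Notation A := (tester m_min Z tau0 tau1 sigma delta rho t).
Local Notation mu := (true_mean m_min Z tau0 tau1 sigma).
Local Notation ideal_verdict := (ideal_verdict m_min Z tau0 tau1 sigma).
Local Notation rounds_failure := (rounds_failure m_min Z tau0 tau1 sigma rho).
Local Notation stage1_far := (stage1_far m_min Z tau0 tau1 sigma delta).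

Hypothesis Zgap : size_invariant_expectation_gap H m_min Z tau0 tau1 sigma.
Hypothesis tau01 : tau0 < tau1.
Hypothesis delta_gt0 : 0 < delta.
Hypothesis delta_le_rho : delta <= rho.
Hypothesis rho_le1 : rho <= 1.
Hypothesis t_bounds : forall k, (1 <= k <= K)%N -> 2 ^- k <= t k <= 1 / 2.
Hypothesis sizes_stage1 : sizes (1 / 8) !=set0.
Hypothesis sizes_round : forall k, (1 <= k <= K)%N -> sizes (t k) !=set0.

Lemma iid_measure_bool_le (P : probability X R) n (b : seq X -> bool) v :
  seq_measurable b -> (iid_integral P n (fun s => (b s)%:R) <= v)%E ->
  (iid P n [set s | b s] <= v)%E.
Proof.
move=> mb; apply: le_trans; rewrite le_eqVlt; apply/orP; left; apply/eqP.
have mB : measurable [set s : n.-tuple X | b s].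
  by have := mb n measurableT [set true] I; rewrite setTI.
have := integral_indic (iid P n) measurableT mB; rewrite setIT => <-.
by apply: eq_integral => s _; rewrite indicE mem_setE.
Qed.

(** Under either hypothesis an accurate stage 1 median fixes the verdict for every threshold, so the
    rounds do not enter the success probability. *)
Lemma verdict_prob_ge P c : model H P ->
  (forall r s, ~~ stage1_far P s -> (seq_tester r s).1 = c) ->
  ((1 - delta)%:E <= verdict_prob Q A P c)%E.
Proof.
move=> HP hc; pose S := [set w : R * budget.-tuple X | (seq_tester w.1 w.2).1 != c].
have mv : measurable_fun setT
    (fun w : R * budget.-tuple X => (seq_tester w.1 w.2).1).
  exact: measurable_seq_tester1.
have mS : measurable S.
  have := mv measurableT [set ~~ c] I; rewrite setTI.
  congr measurable; apply/seteqP; split => w /=; rewrite /S /=.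
    by move=> ->; case: (c).
  by case: (seq_tester _ _).1; case: (c).
have -> : verdict_prob Q A P c = (Q \x iid P budget)%E (~` S).
  rewrite /verdict_prob; congr ((Q \x iid P budget)%E _).
  apply/seteqP; split => w; rewrite /S /= testerE; first by move=> ->; rewrite eqxx.
  by move/negP; rewrite negbK => /eqP.
rewrite probability_setC// EFinB; apply: leeB => //.
apply: (le_trans (threshold_product_le (b := fun=> delta) mS _ _ _)) => //.
- by move=> r; exact: ltW.
- move=> r _; rewrite (_ : xsection S r = [set s | (seq_tester r s).1 != c]); last first.
    by apply/seteqP; split => s; rewrite /xsection /= in_setE.
  apply: (@iid_measure_bool_le _ _ (fun s => (seq_tester r s).1 != c)).
    by apply: (@seq_measurable_neq _ _ (fun s => (seq_tester r s).1)); exact: seq_measurable_tester1.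
  exact: (stage1_decides_le Zgap tau01 delta_gt0 delta_le_rho rho_le1 sizes_stage1 HP (hc r)).
- by rewrite integral_cst//= probability_setT mule1.
Qed.

Lemma tester_succeeds : succeeds H Q A delta.
Proof.
have [mmin _] := batch_size_admissible sizes_stage1.
have [_ null alt _ _] := Zgap.1 _ mmin.
split => P HP; apply: verdict_prob_ge.
- exact: null_hyp_model HP.
- by move=> r s; apply: stage1_accepts => //; exact: null.
- exact: alt_hyp_model HP.
- by move=> r s; apply: stage1_rejects => //; exact: alt.
Qed.

(** The constant is 2 * 17, one share for each run. *)
Lemma tester_replicable : replicable H Q A (34 * rho).
Proof.
move=> P HP; set M := iid P budget.
pose fail r s := (seq_tester r s).1 != ideal_verdict P r.
pose S := [set w : R * (budget.-tuple X * budget.-tuple X) |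
  (seq_tester w.1 w.2.1).1 != (seq_tester w.1 w.2.2).1].
have m1 : measurable_fun setT (fun w : R * (budget.-tuple X * budget.-tuple X) =>
    (seq_tester w.1 w.2.1).1).
  by apply: measurable_seq_tester1 => //; exact: measurableT_comp.
have m2 : measurable_fun setT (fun w : R * (budget.-tuple X * budget.-tuple X) =>
    (seq_tester w.1 w.2.2).1).
  by apply: measurable_seq_tester1 => //; exact: measurableT_comp.
have mS : measurable S.
  have mb : measurable_fun setT (fun w : R * (budget.-tuple X * budget.-tuple X) =>
      if (seq_tester w.1 w.2.1).1 then ~~ (seq_tester w.1 w.2.2).1
      else (seq_tester w.1 w.2.2).1).
    by apply: measurable_fun_ifT => //; exact: measurable_neg.
  have := mb measurableT [set true] I; rewrite setTI.
  congr measurable; apply/seteqP; split => w /=; rewrite /S /=;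
    by case: (seq_tester _ _).1; case: (seq_tester _ _).1.
have -> : agreement_prob Q A P = (Q \x (M \x M))%E (~` S).
  rewrite /agreement_prob; congr ((Q \x (M \x M))%E _).
  apply/seteqP; split => w; rewrite /S /= !testerE; first by move=> ->; rewrite eqxx.
  by move/negP; rewrite negbK => /eqP.
rewrite probability_setC// EFinB; apply: leeB => //.
pose B r := 2 * (delta + rounds_failure P r K).
have B0 r : 0 <= delta + rounds_failure P r K.
  by rewrite addr_ge0 ?rounds_failure_ge0// ltW.
have mB : measurable_fun setT (fun r => delta + rounds_failure P r K).
  by apply: measurable_funD => //; exact: measurable_rounds_failure.
apply: (le_trans (threshold_product_le (b := B) mS _ _ _)).
- exact: measurable_funM.
- by move=> r; rewrite mulr_ge0.
- move=> r r14; pose F := [set s : budget.-tuple X | fail r s].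
  have mfail : seq_measurable (fail r).
    by apply: (@seq_measurable_neq _ _ (fun s => (seq_tester r s).1)); exact: seq_measurable_tester1.
  have mF : measurable F by have := mfail budget measurableT [set true] I; rewrite setTI.
  have hF : (M F <= (delta + rounds_failure P r K)%:E)%E.
    apply: (@iid_measure_bool_le P budget (fail r)) => //.
    exact: (tester_wrong_le Zgap tau01 delta_gt0 delta_le_rho rho_le1 t_bounds
      sizes_stage1 sizes_round HP r14).
  (* For a fixed threshold, two runs that disagree cannot both match the ideal verdict, so one of
     the two samples lies in [F]. *)
  apply: (@le_trans _ _ ((M \x M)%E (F `*` setT `|` setT `*` F))).
    apply: le_measure; rewrite ?inE.
    - exact: measurable_xsection.
    - by apply: measurableU; apply: measurableX.
    - move=> [s1 s2]; rewrite /xsection /= in_setE /S /F /fail /= => ne.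
      have [e|e] := eqVneq (seq_tester r s1).1 (ideal_verdict P r); last by left.
      by right; split => //; rewrite -e eq_sym.
  apply: (le_trans (measureU2 _ _ _)); try exact: measurableX.
  have h1 : ((M \x M)%E (F `*` setT) <= (delta + rounds_failure P r K)%:E)%E.
    by rewrite product_measure1E// [X in (_ * X)%E]probability_setT mule1.
  have h2 : ((M \x M)%E (setT `*` F) <= (delta + rounds_failure P r K)%:E)%E.
    by rewrite product_measure1E// [X in (X * _)%E]probability_setT mul1e.
  by apply: le_trans (leeD h1 h2) _; rewrite -EFinD lee_fin /B mulr_natl mulr2n.
- rewrite /B; under eq_integral do rewrite EFinM.
  rewrite ge0_integralZl//.
  + have := rounds_failure_integral_le m_min Z sigma tau01 delta_gt0 delta_le_rho P.
    move=> h; apply: le_trans (lee_wpmul2l _ h) _ => //.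
    by rewrite -EFinM lee_fin mulrA; lra.
  + exact/measurable_EFinP.
  + by move=> r _; rewrite lee_fin.
Qed.

Lemma tester_expected_samples (C : R) (delta_max : R) : delta <= delta_max ->
  delta_max < 1 -> 256 + (ln delta_max^-1)^-1 <= C ->
  expected_samples_le H Q A
    (C * expected_bound m_min tau0 tau1 sigma delta rho t).
Proof.
move=> dm m1 hC P HP; rewrite /expected_samples unlock.
have m2 : measurable_fun setT (fun w : R * budget.-tuple X =>
    ((seq_tester w.1 w.2).2%:R : R)%:E).
  by apply/measurable_EFinP; exact: measurable_seq_tester2.
have f0 (w : R * budget.-tuple X) : (0 <= ((seq_tester w.1 w.2).2%:R : R)%:E)%E.
  by rewrite lee_fin.
(* The order is chosen so that the threshold is integrated first, with the sample held fixed. *)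
have := @fubini_tonelli2 _ _ (measurableTypeR R) _ R Q (iid P budget) _ m2 f0.
move=> ->.
have bound := expected_cost_le m_min tau0 tau1 sigma t_bounds delta_gt0 dm m1 hC.
apply: (@le_trans _ _ (\int[iid P budget]_s
    (C * expected_bound m_min tau0 tau1 sigma delta rho t)%:E)%E); last first.
  by rewrite integral_cst//= probability_setT mule1.
apply: ge0_le_integral => //.
- by move=> s _; apply: integral_ge0 => r _; rewrite lee_fin.
- apply: measurable_fun_fubini_tonelli_G => //.
- move=> s _; apply: le_trans (tester_cost_integral_le m_min Z sigma delta rho t tau01 s) _.
  by rewrite lee_fin.
Qed.

Lemma tester_worst_case_samples (C : R) (delta_max : R) : delta <= delta_max ->
  delta_max < 1 -> 256 + (ln delta_max^-1)^-1 <= C ->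
  worst_case_samples_le A
    (C * worst_case_bound m_min tau0 tau1 sigma delta rho t).
Proof.
move=> dm m1 hC r s; rewrite testerE.
apply: le_trans (worst_case_cost_le m_min tau0 tau1 sigma t_bounds delta_gt0 dm m1 hC).
rewrite ler_nat; apply: leq_trans (tester_cost_le _ _ _ _ _ _ _ _ _ _) _.
rewrite /sample_budget leq_add2l; apply: leq_trans (rounds_cost_le _ _ _ _ _ _ _ _ _ _) _.
by rewrite /index_iota subn1.
Qed.

End tester_guarantees.

(** The replicability constant is absolute. The sample constant depends on [delta_max] alone: as
    [delta] tends to 1 from below, at least one batch is still drawn while [ln delta^-1] tends to
    0. *)
Theorem mainTheorem11 (R : realType) :
  exists2 Crep : R, 0 < Crep &
  forall delta_max : R, delta_max < 1 ->
  exists2 Csamp : R, 0 < Csamp &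
  forall (d : measure_display) (X : measurableType d)
    (H : testing_problem X R) (m_min : nat)
    (Z : forall m : nat, {mfun m.-tuple X >-> R})
    (tau0 tau1 : R) (sigma : nat -> R) (delta rho : R) (t : nat -> R),
  size_invariant_expectation_gap H m_min Z tau0 tau1 sigma ->
  tau0 < tau1 ->
  0 < delta -> delta <= rho -> rho <= 1 ->
  let K := num_rounds rho in
  (forall k, (1 <= k <= K)%N -> 2 ^- k <= t k <= 1 / 2) ->
  let sizes u := admissible_sizes m_min (noise_ratio tau0 tau1 sigma) u in
  sizes (1 / 8) !=set0 ->
  (forall k, (1 <= k <= K)%N -> sizes (t k) !=set0) ->
  let Q := threshold_law R in
  let A := tester m_min Z tau0 tau1 sigma delta rho t in
  [/\ succeeds H Q A delta,
      replicable H Q A (Crep * rho),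
      delta <= delta_max -> expected_samples_le H Q A
        (Csamp * expected_bound m_min tau0 tau1 sigma delta rho t) &
      delta <= delta_max -> worst_case_samples_le A
        (Csamp * worst_case_bound m_min tau0 tau1 sigma delta rho t)].
Proof.
exists 34 => // delta_max dm1.
(* The absolute value makes the constant positive without a case distinction on the sign of
   [delta_max]. *)
exists (256 + `|(ln delta_max^-1)^-1|); first by rewrite ltr_pwDl.
move=> d X H m_min Z tau0 tau1 sigma delta rho t Zgap tau01 d0 drho rho1 K tb sizes s8 sk Q A.
have C_ge : 256 + (ln delta_max^-1)^-1 <= 256 + `|(ln delta_max^-1)^-1|.
  by rewrite lerD2l ler_norm.
split.
- exact: (tester_succeeds t Zgap tau01 d0 drho rho1 s8).
- exact: (tester_replicable Zgap tau01 d0 drho rho1 tb s8 sk).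
- by move=> dm; exact: (tester_expected_samples m_min Z sigma tau01 d0 tb dm dm1 C_ge).
- by move=> dm; exact: (tester_worst_case_samples Z d0 tb dm dm1 C_ge).
Qed.
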